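(* There exist a free $(\mathbb Z\times\mathbb Z)$-module $M$ of finite rank and a fixed finitely generated subsemimodule $N$ of $M$ such that membership in $N$ is undecidable: there is no algorithm that, given an element of $M$, decides whether it belongs to $N$.
   Context: A free $(\mathbb Z\times\mathbb Z)$-module of rank $k$ is a free module over the group ring $\mathbb Z[\mathbb Z\times\mathbb Z]$ on $k$ generators; its elements can be identified with finitely supported functions $(\mathbb Z\times\mathbb Z)\times X\to\mathbb Z$ ($|X|=k$) with pointwise addition and action $(g_0f)(g,x)=f(g_0^{-1}g,x)$, and are given to the algorithm in this (finite) form. A subsemimodule is a submonoid closed under the action of $\mathbb Z\times\mathbb Z$; it is finitely generated if it is the set of all finite sums $\sum_i g_i b_i$ with $g_i\in\mathbb Z\times\mathbb Z$ and $b_i$ from a fixed finite set. *)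

(* Defs.v *)
From Stdlib Require Import ZArith List Arith Bool.
Import ListNotations.
Open Scope Z_scope.

(* Kleene's partial (mu-)recursive functions on nat, with a big-step
   evaluation relation.  "Algorithm" = program of this language. *)
Inductive rcode : Type :=
| RZero : rcode
| RSucc : rcode
| RProj : nat -> rcode
| RComp : rcode -> list rcode -> rcode
| RPrim : rcode -> rcode -> rcode
| RMu   : rcode -> rcode.

Inductive reval : rcode -> list nat -> nat -> Prop :=
| ev_zero : forall v, reval RZero v 0
| ev_succ : forall x v, reval RSucc (x :: v) (S x)
| ev_proj : forall i v, (i < length v)%nat -> reval (RProj i) v (nth i v 0%nat)
| ev_comp : forall f gs v ws y,
    revals gs v ws -> reval f ws y -> reval (RComp f gs) v y
| ev_prim0 : forall f g v y, reval f v y -> reval (RPrim f g) (0%nat :: v) y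
| ev_primS : forall f g n v z y,
    reval (RPrim f g) (n :: v) z -> reval g (n :: z :: v) y ->
    reval (RPrim f g) (S n :: v) y
| ev_mu : forall f v n,
    reval f (n :: v) 0 ->
    (forall m, (m < n)%nat -> exists y, reval f (m :: v) (S y)) ->
    reval (RMu f) v n
with revals : list rcode -> list nat -> list nat -> Prop :=
| evs_nil : forall v, revals [] v []
| evs_cons : forall g gs v y ys,
    reval g v y -> revals gs v ys -> revals (g :: gs) v (y :: ys).

Definition npair (a b : nat) : nat := ((a + b) * (a + b + 1) / 2 + b)%nat.
Definition enc_Z (z : Z) : nat :=
  if (0 <=? z) then (2 * Z.to_nat z)%nat else (2 * Z.to_nat (- z) - 1)%nat.

(* An element of the free (Z x Z)-module of rank k, in finite form: a list of
   entries (a, b, x, c), meaning the finitely supported function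
   ((a,b), x) |-> c summed over the entries; x ranges over X = {0,...,k-1}. *)
Definition entry := (Z * Z * nat * Z)%type.
Definition elem := list entry.

Definition enc_entry (q : entry) : nat :=
  match q with (a, b, x, c) => npair (npair (enc_Z a) (enc_Z b)) (npair x (enc_Z c)) end.
Fixpoint enc_elem (l : elem) : nat :=
  match l with
  | [] => 0%nat
  | q :: l' => S (npair (enc_entry q) (enc_elem l'))
  end.

Definition valid (k : nat) (l : elem) : Prop :=
  Forall (fun q : entry => match q with (_, _, x, _) => (x < k)%nat end) l.

Definition den (l : elem) (a b : Z) (x : nat) : Z :=
  fold_right (fun (q : entry) acc =>
    match q with (a', b', x', c) =>
      (if andb (andb (a' =? a) (b' =? b)) (Nat.eqb x' x) then c else 0) + acc end) 0 l.

Definition act (g1 g2 : Z) (f : Z -> Z -> nat -> Z) : Z -> Z -> nat -> Z :=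
  fun a b x => f (a - g1) (b - g2) x.

Definition in_subsemimodule (B : list elem) (l : elem) : Prop :=
  exists terms : list (Z * Z * elem),
    Forall (fun t : Z * Z * elem => In (snd t) B) terms /\
    forall a b x,
      den l a b x =
      fold_right (fun (t : Z * Z * elem) acc =>
        match t with (g1, g2, bi) => act g1 g2 (den bi) a b x + acc end) 0 terms.

Definition decides (k : nat) (P : elem -> Prop) (p : rcode) : Prop :=
  forall l, valid k l ->
    (P l -> reval p [enc_elem l] 1%nat) /\ (~ P l -> reval p [enc_elem l] 0%nat).

(* Main.v *)
(* Reading one coordinate of Z x Z as position and the other as time, the identity l = sum of translates of (inputs at time 0 minus outputs at time 1) says that the particles listed in l can be consumed by events, each of which only needs particles present at its time, until nothing is left. Since every event consumes something and finitely many events occur, such a solution is a causal, synchronous run of a particle system on the line. A one-head machine is such a system: the head consumes the symbol below it, the other symbols stay or vanish, and the head itself disappears only in state Accept; so l lies in the semimodule iff the machine accepts.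

   The machine is fixed and interprets a program text standing on its tape, so an arbitrary recursive function q can be put into l. A number n enters as the position of a single particle, hence for l = (n,0,x,1) :: l' with n the code of l' the code of l is an arithmetic function s of n. Taking for q the composition of a putative decision procedure with s, the machine started on l accepts iff the procedure rejects l. *)

Require Import Defs.
From Stdlib Require Import ZArith List Lia Permutation Bool Arith.
Import ListNotations.
Open Scope nat_scope.

(** * Recursive arithmetic: pairing and the code of an extended element *)

Lemma revals_spec gs v ws : revals gs v ws <-> Forall2 (fun g y => reval g v y) gs ws.
Proof.
  split.
  - induction 1; constructor; auto.
  - induction 1; constructor; auto.
Qed.

Fixpoint rconst (k : nat) : rcode :=
  match k with 0 => RZero | S k => RComp RSucc [rconst k] end.

Definition radd : rcode := RPrim (RProj 0) (RComp RSucc [RProj 1]).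
Definition rtri : rcode := RPrim RZero (RComp RSucc [RComp radd [RProj 0; RProj 1]]).
Definition rpair : rcode := RComp radd [RComp rtri [radd]; RProj 1].
Definition rap2 (f g h : rcode) : rcode := RComp f [g; h].

Lemma reval_rconst k v : reval (rconst k) v k.
Proof.
  induction k; simpl; [constructor|].
  apply ev_comp with [k]; [|constructor].
  now repeat constructor.
Qed.

Lemma reval_rap2 f g h v a b y :
  reval g v a -> reval h v b -> reval f [a; b] y -> reval (rap2 f g h) v y.
Proof.
  intros. apply ev_comp with [a; b]; auto. now repeat constructor.
Qed.

Lemma reval_rproj i v y : nth_error v i = Some y -> reval (RProj i) v y.
Proof.
  intros H. rewrite <- (nth_error_nth v i 0 H).
  constructor. apply nth_error_Some. congruence.
Qed.

Lemma reval_rsucc g v y : reval g v y -> reval (RComp RSucc [g]) v (S y).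
Proof.
  intros. apply ev_comp with [y]; [|constructor]. now repeat constructor.
Qed.

Lemma reval_radd a b : reval radd [a; b] (a + b).
Proof.
  induction a.
  - apply ev_prim0. now apply reval_rproj.
  - eapply ev_primS; [exact IHa|]. apply reval_rsucc. now apply reval_rproj.
Qed.

(** Triangular numbers in the form of a primitive recursion, which replaces the division in
    [npair]. *)
Fixpoint tri (n : nat) : nat := match n with 0 => 0 | S n => S (n + tri n) end.

Lemma reval_rtri a v : reval rtri (a :: v) (tri a).
Proof.
  induction a.
  - apply ev_prim0. constructor.
  - eapply ev_primS; [exact IHa|]. apply reval_rsucc.
    eapply reval_rap2; [now apply reval_rproj..|]. apply reval_radd.
Qed.

Lemma npair_tri a b : npair a b = tri (a + b) + b.
Proof.
  assert (E : forall n, n * (n + 1) = tri n * 2) by (induction n; simpl; lia).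
  unfold npair. now rewrite E, Nat.div_mul.
Qed.

Lemma reval_rpair a b : reval rpair [a; b] (npair a b).
Proof.
  rewrite npair_tri. eapply reval_rap2.
  - apply ev_comp with [a + b]; [|apply reval_rtri].
    repeat constructor. apply reval_radd.
  - now apply reval_rproj.
  - apply reval_radd.
Qed.

Lemma enc_Z_of_nat n : enc_Z (Z.of_nat n) = n + n.
Proof.
  unfold enc_Z. destruct (Z.leb_spec 0 (Z.of_nat n)); lia.
Qed.

(* Since the new entry sits at position n, the code of (n,0,x,1) :: l is an arithmetic function of n when n is the code of l. *)
Definition rself (x : nat) : rcode :=
  RComp RSucc [rap2 rpair
    (rap2 rpair (rap2 rpair (rap2 radd (RProj 0) (RProj 0)) (rconst 0))
                (rap2 rpair (rconst x) (rconst 2)))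
    (RProj 0)].

Lemma reval_rself x l :
  let n := enc_elem l in
  reval (rself x) [n] (enc_elem ((Z.of_nat n, 0%Z, x, 1%Z) :: l)).
Proof.
  (* [enc_Z] sends [Z.of_nat n] to [n + n], and the integers 0 and 1 to the constants 0 and 2 in
     [rself]. *)
  intros n. cbn [enc_elem]. fold n. unfold enc_entry. rewrite enc_Z_of_nat.
  apply reval_rsucc.
  eapply reval_rap2; [|now apply reval_rproj|apply reval_rpair].
  eapply reval_rap2; [| |apply reval_rpair].
  - eapply reval_rap2; [|apply reval_rconst|apply reval_rpair].
    eapply reval_rap2; [now apply reval_rproj..|apply reval_radd].
  - eapply reval_rap2; [apply reval_rconst..|apply reval_rpair].
Qed.

(** * Compiling recursive functions to while programs *)

Inductive wcmd : Type :=
| WInc : nat -> wcmd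
| WDec : nat -> wcmd
| WSeq : wcmd -> wcmd -> wcmd
| WWhile : nat -> wcmd -> wcmd.

Notation "a ;; b" := (WSeq a b) (at level 60, right associativity).

Inductive wexec : wcmd -> (nat -> nat) -> (nat -> nat) -> Prop :=
| wx_inc : forall i f f',
    (forall r, f' r = if r =? i then S (f i) else f r) -> wexec (WInc i) f f'
| wx_dec : forall i f f',
    (forall r, f' r = if r =? i then pred (f i) else f r) -> wexec (WDec i) f f'
| wx_seq : forall a b f g h, wexec a f g -> wexec b g h -> wexec (a ;; b) f h
| wx_while0 : forall i c f, f i = 0 -> wexec (WWhile i c) f f
| wx_whileS : forall i c f g h,
    f i <> 0 -> wexec c f g -> wexec (WWhile i c) g h -> wexec (WWhile i c) f h.

Definition upd (f : nat -> nat) (i v : nat) : nat -> nat :=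
  fun r => if r =? i then v else f r.

(* Programs are specified up to pointwise equality of the register contents. *)
Definition runs (c : wcmd) (f : nat -> nat) (Q : (nat -> nat) -> Prop) : Prop :=
  exists f', wexec c f f' /\ Q f'.

Ltac regs := unfold upd in *;
  repeat match goal with
  | |- context [?a =? ?b] => destruct (Nat.eqb_spec a b)
  | H : context [?a =? ?b] |- _ => destruct (Nat.eqb_spec a b)
  end; subst; try congruence; try lia; auto.

Lemma runs_inc i f : runs (WInc i) f (fun g => forall r, g r = upd f i (S (f i)) r).
Proof. exists (upd f i (S (f i))). split; auto. now constructor. Qed.

Lemma runs_dec i f : runs (WDec i) f (fun g => forall r, g r = upd f i (pred (f i)) r).
Proof. exists (upd f i (pred (f i))). split; auto. now constructor. Qed.

Lemma runs_seq a b f P Q :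
  runs a f P -> (forall g, P g -> runs b g Q) -> runs (a ;; b) f Q.
Proof.
  intros (g & Hg & HP) H. destruct (H g HP) as (h & Hh & HQ).
  exists h. split; auto. econstructor; eauto.
Qed.

Lemma runs_weaken c f (P Q : _ -> Prop) : runs c f P -> (forall g, P g -> Q g) -> runs c f Q.
Proof. intros (g & Hg & HP) H. exists g; auto. Qed.

(** Total correctness of loops: the index of the invariant counts the remaining iterations. *)
Lemma runs_while i c (I : nat -> (nat -> nat) -> Prop) (Q : (nat -> nat) -> Prop) :
  (forall f, I 0 f -> f i = 0 /\ Q f) ->
  (forall n f, I (S n) f -> f i <> 0 /\ runs c f (I n)) ->
  forall n f, I n f -> runs (WWhile i c) f Q.
Proof.
  intros H0 HS. induction n; intros f Hf.
  - destruct (H0 f Hf). exists f. split; auto. now constructor.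
  - destruct (HS n f Hf) as [? (g & Hg & HI)]. destruct (IHn g HI) as (h & ? & ?).
    exists h. split; auto. econstructor; eauto.
Qed.

Definition wclear (i : nat) : wcmd := WWhile i (WDec i).

Lemma runs_clear i f : runs (wclear i) f (fun g => forall r, g r = upd f i 0 r).
Proof.
  apply runs_while with (n := f i) (I := fun n g => g i = n /\ forall r, r <> i -> g r = f r).
  - intros g [H1 H2]. split; auto. intros r. regs.
  - intros n g [H1 H2]. split; [lia|]. eapply runs_weaken; [apply runs_dec|].
    intros h Hh. split; [|intros r Hr]; rewrite Hh; regs.
  - auto.
Qed.

(** Counting down destroys the source, so a second copy is kept in [tmp] to restore it. *)
Definition wcopy (src dst tmp : nat) : wcmd :=
  wclear dst ;; wclear tmp ;;
  WWhile src (WDec src ;; WInc dst ;; WInc tmp) ;;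
  WWhile tmp (WDec tmp ;; WInc src).

Lemma runs_copy src dst tmp f :
  src <> dst -> src <> tmp -> dst <> tmp ->
  runs (wcopy src dst tmp) f
    (fun g => forall r, r <> tmp -> g r = upd f dst (f src) r).
Proof.
  intros D1 D2 D3. unfold wcopy.
  eapply runs_seq; [apply runs_clear|]. intros g Hg.
  eapply runs_seq; [apply runs_clear|]. intros h Hh.
  eapply runs_seq with (P := fun k => k src = 0 /\ k tmp = f src /\
    forall r, r <> src -> r <> tmp -> k r = upd f dst (f src) r).
  - apply runs_while with (n := f src)
      (I := fun n k => k src = n /\ k tmp + n = f src /\ k dst + n = f src /\
         forall r, r <> src -> r <> tmp -> r <> dst -> k r = f r).
    + intros k (K1 & K2 & K3 & K4). repeat split; auto; try lia.
      intros r ? ?. specialize (K4 r). regs.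
    + intros n k (K1 & K2 & K3 & K4). split; [lia|].
      eapply runs_seq; [apply runs_dec|]. intros k1 E1.
      eapply runs_seq; [apply runs_inc|]. intros k2 E2.
      eapply runs_weaken; [apply runs_inc|]. intros k3 E3.
      repeat split; [..|intros r ? ? ?]; rewrite E3; regs; rewrite ?E2; regs; rewrite ?E1; regs.
    + repeat split; [..|intros r ? ? ?]; rewrite Hh; regs; rewrite Hg; regs.
  - intros k (K1 & K2 & K3).
    apply runs_while with (n := f src)
      (I := fun n j => j tmp = n /\ j src + n = f src /\
         forall r, r <> src -> r <> tmp -> j r = upd f dst (f src) r).
    + intros j (J1 & J2 & J3). split; auto. intros r Hr.
      destruct (Nat.eq_dec r src); [subst; regs|]. now apply J3.
    + intros n j (J1 & J2 & J3). split; [lia|].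
      eapply runs_seq; [apply runs_dec|]. intros k1 E1.
      eapply runs_weaken; [apply runs_inc|]. intros k2 E2.
      repeat split; [..|intros r ? ?; rewrite <- J3 by auto]; rewrite E2; regs; rewrite ?E1; regs.
    + repeat split; auto; lia.
Qed.

(* [comp c ins out fr] leaves in register [out] the value of [c] on the contents of [ins]; registers from [fr] on are scratch. *)
Fixpoint comp (c : rcode) (ins : list nat) (out fr : nat) : wcmd :=
  match c with
  | RZero => wclear out
  | RSucc => wcopy (nth 0 ins 0) out fr ;; WInc out
  | RProj i => wcopy (nth i ins 0) out fr
  | RComp f gs =>
      let m := length gs in
      (fix go (gs : list rcode) (o : nat) : wcmd :=
         match gs with
         | [] => comp f (seq fr m) out (fr + m)
         | g :: gs => comp g ins o (fr + m) ;; go gs (S o)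
         end) gs fr
  | RPrim f g =>
      let vs := tl ins in
      let k := fr in let acc := S fr in let new := S (S fr) in let lim := S (S (S fr)) in
      let fr := S (S (S (S fr))) in
      comp f vs acc fr ;; wclear k ;; wcopy (hd 0 ins) lim fr ;;
      WWhile lim (WDec lim ;; comp g (k :: acc :: vs) new fr ;; wcopy new acc fr ;; WInc k) ;;
      wcopy acc out fr
  | RMu f =>
      let k := fr in let z := S fr in let fr := S (S fr) in
      wclear k ;; comp f (k :: ins) z fr ;;
      WWhile z (WInc k ;; comp f (k :: ins) z fr) ;;
      wcopy k out fr
  end.

(** The inputs lie below [fr] and differ from [out], so they survive the run and can be read by
    later calls. *)
Definition comp_spec (c : rcode) : Prop := forall v y, reval c v y ->
  forall ins out fr f, map f ins = v -> Forall (fun i => i < fr) ins -> ~ In out ins -> out < fr ->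
  runs (comp c ins out fr) f (fun g => g out = y /\ forall r, r < fr -> r <> out -> g r = f r).

(** Structural induction has to reach the codes inside the list of [RComp], which takes an inner
    induction on that list. *)
Lemma rcode_nested_ind (P : rcode -> Prop) :
  P RZero -> P RSucc -> (forall i, P (RProj i)) ->
  (forall f gs, P f -> Forall P gs -> P (RComp f gs)) ->
  (forall f g, P f -> P g -> P (RPrim f g)) ->
  (forall f, P f -> P (RMu f)) -> forall c, P c.
Proof.
  intros Hz Hs Hp Hc Hr Hm. fix IH 1. intros [| |i|f gs|f g|f]; [assumption|assumption|apply Hp| |apply Hr; apply IH|apply Hm; apply IH].
  apply Hc; [apply IH|]. induction gs; constructor; auto.
Qed.

Lemma map_agree (f g : nat -> nat) ins :
  (forall r, In r ins -> g r = f r) -> map g ins = map f ins.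
Proof. intros H. apply map_ext_in. auto. Qed.

Lemma nth_map_lt (f : nat -> nat) ins i :
  i < length ins -> nth i (map f ins) 0 = f (nth i ins 0).
Proof.
  intros H. rewrite <- (map_nth f). apply nth_indep. now rewrite length_map.
Qed.

Lemma comp_spec_comp f gs : comp_spec f -> Forall comp_spec gs -> comp_spec (RComp f gs).
Proof.
  intros Hf Hgs v y H ins out fr m0 Hins Hlt Hout Hofr.
  inversion H as [| | |? ? ? ws ? Hrs Hrf| | |]; subst. apply revals_spec in Hrs.
  pose proof (Forall2_length Hrs) as Hlen.
  cbn [comp]. remember (length gs) as m eqn:Em.
  set (go := fix go (gs : list rcode) (o : nat) : wcmd := _).
  (* [done] lists the values already computed, stored from register [fr] on; the induction runs over
     the functions still to be evaluated. *)
  assert (G : forall gs ws, Forall comp_spec gs ->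
     Forall2 (fun g y => reval g (map m0 ins) y) gs ws ->
     forall done, length done + length ws = m ->
     forall g, (forall r, r < fr -> g r = m0 r) ->
       map g (seq fr (length done)) = done ->
       reval f (done ++ ws) y ->
       runs (go gs (fr + length done)) g
         (fun g => g out = y /\ forall r, r < fr -> r <> out -> g r = m0 r)).
  { clear H Hrs Hrf Hlen Hgs Em. clear gs ws. intros gs ws Hgs Hrs.
    revert Hgs. induction Hrs as [|g0 y0 gs ws Hg0 Hrs IH]; intros Hgs done Hd g Hg Hgd Hy.
    - simpl in *. rewrite app_nil_r in Hy. rewrite Nat.add_0_r in Hd. subst m.
      eapply runs_weaken; [apply (Hf _ _ Hy)|].
      + auto.
      + apply Forall_forall. intros i Hi%in_seq. lia.
      + intros Hi%in_seq. lia.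
      + lia.
      + intros h [h1 h2]. split; auto. intros r Hr Hro. rewrite h2; auto. lia.
    - pose proof (Forall_inv Hgs) as Hs0. pose proof (Forall_inv_tail Hgs) as Hss. simpl in Hd.
      change (go (g0 :: gs) (fr + length done)) with
        (comp g0 ins (fr + length done) (fr + m) ;;
         go gs (S (fr + length done))).
      eapply runs_seq; [apply (Hs0 _ _ Hg0)|].
      + apply map_agree. intros r Hr. apply Hg. now apply (proj1 (Forall_forall _ _) Hlt).
      + eapply Forall_impl; [|exact Hlt]. simpl; intros; lia.
      + intros Hi. apply (proj1 (Forall_forall _ _) Hlt) in Hi. lia.
      + lia.
      + intros h [h1 h2].
        replace (S (fr + length done)) with (fr + length (done ++ [y0]))
          by (rewrite length_app; simpl; lia).
        apply IH; auto.
        * rewrite length_app; simpl; lia.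
        * intros r Hr. rewrite h2 by lia. auto.
        * rewrite length_app. simpl. rewrite Nat.add_1_r, seq_S, map_app. simpl.
          rewrite h1. f_equal. rewrite <- Hgd at 2. apply map_agree.
          intros r Hr%in_seq. apply h2; lia.
        * now rewrite <- app_assoc. }
  specialize (G gs ws Hgs Hrs []). simpl in G. rewrite Nat.add_0_r in G.
  apply G; auto.
Qed.

Lemma comp_spec_prim f g : comp_spec f -> comp_spec g -> comp_spec (RPrim f g).
Proof.
  intros Hf Hg v y H ins out fr m0 Hins Hlt Hout Hofr.
  destruct ins as [|i0 vs]; [simpl in Hins; subst; inversion H|].
  simpl in Hins. cbn [comp tl hd].
  inversion Hlt as [|? ? Hi0 Hvs]; subst. simpl in Hout.
  assert (Hin : forall r, In r vs -> r < fr) by now apply Forall_forall.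
  (* The derivation is unrolled into the sequence [F] of values of the recursion at 0, 1, ...,
     [m0 i0]. *)
  assert (R : exists F, F (m0 i0) = y /\ reval f (map m0 vs) (F 0) /\
    forall j, j < m0 i0 -> reval g (j :: F j :: map m0 vs) (F (S j))).
  { revert H. generalize (m0 i0), y. induction n as [|n IH]; intros z Hz.
    - exists (fun _ => z). inversion Hz; subst. repeat split; auto. intros; lia.
    - inversion Hz as [| | | | |? ? ? ? z' ? Hz1 Hz2|]; subst.
      destruct (IH _ Hz1) as (F & F1 & F2 & F3).
      exists (upd F (S n) z). repeat split; [regs..|].
      intros j Hj. unfold upd at 1. destruct (Nat.eqb_spec j (S n)); [lia|].
      unfold upd. destruct (Nat.eqb_spec (S j) (S n)).
      + replace j with n by lia. now rewrite F1.
      + apply F3. lia. }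
  destruct R as (F & <- & R0 & RS). clear H.
  set (fr' := S (S (S (S fr)))).
  eapply runs_seq; [apply (Hf _ _ R0)|].
  - auto.
  - eapply Forall_impl; [|exact Hvs]. unfold fr'; simpl; intros; lia.
  - intros Hi%Hin. lia.
  - unfold fr'; lia.
  - intros g1 [A1 A2].
    eapply runs_seq; [apply runs_clear|]. intros g2 A3.
    eapply runs_seq; [apply runs_copy; unfold fr'; lia|]. intros g3 A4.
    eapply runs_seq with (P := fun h => h (S fr) = F (m0 i0) /\
       forall r, r < fr -> h r = m0 r).
    (* With [n] iterations left, [lim] holds [n], the counter holds [m0 i0 - n], and [acc] holds the
       value of [F] there. *)
    + apply runs_while with (n := m0 i0)
        (I := fun n h => h (S (S (S fr))) = n /\ n <= m0 i0 /\ h fr = m0 i0 - n /\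
              h (S fr) = F (m0 i0 - n) /\ forall r, r < fr -> h r = m0 r).
      * intros h (B1 & B2 & B3 & B4 & B5). rewrite Nat.sub_0_r in B4. auto.
      * intros n h (B1 & B2 & B3 & B4 & B5). split; [lia|].
        eapply runs_seq; [apply runs_dec|]. intros h1 C1.
        assert (D1 : forall r, r < S (S (S fr)) -> h1 r = h r) by (intros; rewrite C1; regs).
        assert (J : m0 i0 - S n < m0 i0) by lia.
        eapply runs_seq; [apply (Hg _ _ (RS _ J))|].
        -- simpl. rewrite !D1 by lia. rewrite B3, B4. do 2 f_equal.
           apply map_agree. intros r Hr%Hin. rewrite D1 by lia. auto.
        -- repeat constructor; unfold fr'; try lia.
           eapply Forall_impl; [|exact Hvs]. simpl; intros; lia.
        -- intros [Hi|[Hi|Hi%Hin]]; lia.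
        -- unfold fr'; lia.
        -- intros h2 [C2 C3].
           eapply runs_seq; [apply runs_copy; unfold fr'; lia|]. intros h3 C4.
           eapply runs_weaken; [apply runs_inc|]. intros h4 C5.
           replace (S (m0 i0 - S n)) with (m0 i0 - n) in C2 by lia.
           unfold fr' in *.
           repeat split.
           ++ rewrite C5; regs. rewrite C4 by lia. regs. rewrite C3 by lia. rewrite C1. regs.
           ++ lia.
           ++ rewrite C5; regs. rewrite C4 by lia. regs. rewrite C3 by lia. rewrite C1. regs.
           ++ rewrite C5; regs. rewrite C4 by lia. regs.
           ++ intros r Hr. rewrite C5; regs. rewrite C4 by lia. regs. rewrite C3 by lia.
              rewrite C1. regs.
      * unfold fr' in *. rewrite Nat.sub_diag.
        assert (E : forall r, r < fr -> g3 r = m0 r).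
        { intros r Hr. rewrite A4 by lia. regs. rewrite A3. regs. apply A2; lia. }
        repeat split; auto.
        -- rewrite A4 by lia. regs. rewrite A3. regs. apply A2; lia.
        -- rewrite A4 by lia. regs. rewrite A3. regs.
        -- rewrite A4 by lia. regs. rewrite A3. regs.
    + intros h [B1 B2]. eapply runs_weaken; [apply runs_copy; unfold fr'; lia|].
      intros h' B3. unfold fr' in *. split; [|intros r Hr1 Hr2]; rewrite B3 by lia; regs.
Qed.

Lemma comp_spec_mu f : comp_spec f -> comp_spec (RMu f).
Proof.
  intros Hf v y H ins out fr m0 Hins Hlt Hout Hofr.
  inversion H as [| | | | | |? ? ? Hz Hnz]; subst. cbn [comp].
  assert (Hin : forall r, In r ins -> r < fr) by now apply Forall_forall.
  set (fr' := S (S fr)).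
  (* One evaluation at counter value [k]: the test register becomes zero exactly when [k] has
     reached [y]. *)
  assert (S0 : forall k h, k <= y -> h fr = k -> (forall r, r < fr -> h r = m0 r) ->
     runs (comp f (fr :: ins) (S fr) fr') h (fun h => h fr = k /\
       (k < y -> h (S fr) <> 0) /\ (k = y -> h (S fr) = 0) /\ forall r, r < fr -> h r = m0 r)).
  { intros k h Hk Hh Hr.
    assert (Hv : exists z, reval f (k :: map m0 ins) z /\ (k < y -> z <> 0) /\ (k = y -> z = 0)).
    { destruct (Nat.eq_dec k y) as [->|].
      - exists 0. repeat split; auto; lia.
      - destruct (Hnz k) as [z ?]; [lia|]. exists (S z). repeat split; auto; lia. }
    destruct Hv as (z & Z1 & Z2 & Z3).
    eapply runs_weaken; [apply (Hf _ _ Z1)|].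
    - simpl. rewrite Hh. f_equal. apply map_agree. auto.
    - constructor; [unfold fr'; lia|]. eapply Forall_impl; [|exact Hlt].
      unfold fr'; simpl; intros; lia.
    - intros [Hi|Hi%Hin]; lia.
    - unfold fr'; lia.
    - intros g [G1 G2]. rewrite G1. unfold fr' in *. repeat split; auto.
      + rewrite G2; lia.
      + intros r ?. rewrite G2 by lia. auto. }
  eapply runs_seq; [apply runs_clear|]. intros g1 A1.
  eapply runs_seq; [apply (S0 0)|].
  - lia.
  - rewrite A1; regs.
  - intros. rewrite A1; regs.
  - intros g2 A2.
    eapply runs_seq with (P := fun h => h fr = y /\ forall r, r < fr -> h r = m0 r).
    (* The index is the distance of the counter from [y]; the test register already holds the value
       at the current counter. *)
    + apply runs_while with (n := y) (I := fun n h => n <= y /\ h fr = y - n /\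
        (y - n < y -> h (S fr) <> 0) /\ (y - n = y -> h (S fr) = 0) /\
        forall r, r < fr -> h r = m0 r).
      * intros h (B1 & B2 & B3 & B4 & B5). rewrite Nat.sub_0_r in *. auto.
      * intros n h (B1 & B2 & B3 & B4 & B5). split; [apply B3; lia|].
        eapply runs_seq; [apply runs_inc|]. intros h1 C1.
        eapply runs_weaken; [apply (S0 (y - n))|].
        -- lia.
        -- rewrite C1; regs.
        -- intros. rewrite C1; regs.
        -- intros h2 C2. simpl. split; [lia|]. exact C2.
      * simpl. rewrite Nat.sub_diag. split; [lia|]. exact A2.
    + intros h [B1 B2]. eapply runs_weaken; [apply runs_copy; unfold fr'; lia|].
      intros h' B3. unfold fr' in *. split; [|intros r Hr1 Hr2]; rewrite B3 by lia; regs.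
Qed.

Lemma comp_correct c : comp_spec c.
Proof.
  induction c using rcode_nested_ind.
  - intros v y H ins out fr f Hins Hlt Hout Hofr. inversion H; subst.
    eapply runs_weaken; [apply runs_clear|]. intros g Hg. split; [|intros]; rewrite Hg; regs.
  - intros v y H ins out fr f <- Hlt Hout Hofr.
    destruct ins as [|i ins]; [inversion H|]. cbn [comp nth]. simpl in *.
    inversion H; subst. apply Forall_inv in Hlt.
    eapply runs_seq; [apply runs_copy; lia|]. intros g Hg.
    eapply runs_weaken; [apply runs_inc|]. intros h Hh.
    split; [|intros]; rewrite Hh; regs; rewrite Hg by lia; regs.
  - intros v y H ins out fr f <- Hlt Hout Hofr. inversion H as [| |? ? Hi| | | |]; subst.
    rewrite length_map in *. rewrite nth_map_lt by auto. cbn [comp].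
    pose proof (nth_In ins 0 Hi) as Hn. pose proof (proj1 (Forall_forall _ _) Hlt _ Hn) as Hl.
    simpl in Hl.
    assert (nth i ins 0 <> out) by congruence.
    eapply runs_weaken; [apply runs_copy; lia|]. intros g Hg.
    split; [|intros]; rewrite Hg by lia; regs.
  - now apply comp_spec_comp.
  - now apply comp_spec_prim.
  - now apply comp_spec_mu.
Qed.

(** * A fixed one-head machine interpreting program texts on its tape *)

Inductive op := MR | ML | INC | DEC | OPEN | CLOSE | HALT.
(* MIP marks the instruction being executed, ME an open loop being executed (or skipped as part of a bigger loop), MS the loop whose skipping ends the skip mode. *)
Inductive mark := M0 | MIP | ME | MS.
(* The memory is a list of blocks, each preceded by [Cell None], or by [Ptr] for the current one; the value of a register is the number of [Cell (Some true)] in its block. *)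
Inductive sym := Prog (o : op) (m : mark) | Cell (c : option bool) | Ptr | End.
Inductive state :=
| Pave | Fetch | Seek (o : op) | NextReg | PrevReg | Insert (c : option bool) | Decr
| Test (o : op) | Return | ReturnTest (b : bool) | Back | Skip | SkipBack | SkipFwd (b : bool)
| Accept | Reject.
Inductive dir := Lt | St | Rt.

(** An instruction cycle: [Fetch] marks an instruction, [Seek] carries it to [Ptr], a memory state
    executes it, and [Return] goes back to the mark. [Decr] turns a true cell into a false one, so
    cells never have to be removed. Two symbols are written only at [End], which thereby moves one
    cell to the right. *)
Definition delta (q : state) (a : sym) : option (state * dir * list sym) :=
  match q, a with
  | Pave, End => Some (Return, Lt, [End])
  | Fetch, Prog CLOSE M0 => Some (Back, Lt, [a])
  | Fetch, Prog o M0 => Some (Seek o, Rt, [Prog o MIP])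
  | Seek o, Ptr =>
      match o with
      | MR => Some (NextReg, Rt, [Cell None])
      | ML => Some (PrevReg, Lt, [Cell None])
      | INC => Some (Insert (Some true), Rt, [Ptr])
      | DEC => Some (Decr, Rt, [Ptr])
      | _ => Some (Test o, Rt, [Ptr])
      end
  | Seek o, End => None
  | Seek o, _ => Some (Seek o, Rt, [a])
  | NextReg, Cell (Some _) => Some (NextReg, Rt, [a])
  | NextReg, Cell None => Some (Return, Lt, [Ptr])
  | NextReg, End => Some (Return, Lt, [Ptr; End])
  | PrevReg, Cell (Some _) => Some (PrevReg, Lt, [a])
  | PrevReg, Cell None => Some (Return, Lt, [Ptr])
  | Insert c, Cell c' => Some (Insert c', Rt, [Cell c])
  | Insert c, End => Some (Return, Lt, [Cell c; End])
  | Decr, Cell (Some false) => Some (Decr, Rt, [a])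
  | Decr, Cell (Some true) => Some (Return, Lt, [Cell (Some false)])
  | Decr, _ => Some (Return, Lt, [a])
  | Test o, Cell (Some false) => Some (Test o, Rt, [a])
  | Test HALT, Cell (Some true) => Some (Reject, Lt, [a])
  | Test HALT, _ => Some (Accept, Lt, [a])
  | Test _, Cell (Some true) => Some (ReturnTest true, Lt, [a])
  | Test _, _ => Some (ReturnTest false, Lt, [a])
  | Return, Prog o MIP => Some (Fetch, Rt, [Prog o M0])
  | Return, _ => Some (Return, Lt, [a])
  | ReturnTest b, Prog o MIP =>
      if b then Some (Fetch, Rt, [Prog o ME]) else Some (Skip, Rt, [Prog o MS])
  | ReturnTest _, _ => Some (q, Lt, [a])
  | Back, Prog o ME => Some (Fetch, St, [Prog o M0])
  | Back, _ => Some (Back, Lt, [a])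
  | Skip, Prog OPEN M0 => Some (Skip, Rt, [Prog OPEN ME])
  | Skip, Prog CLOSE M0 => Some (SkipBack, Lt, [Prog CLOSE MIP])
  | Skip, _ => Some (Skip, Rt, [a])
  | SkipBack, Prog o ME => Some (SkipFwd false, Rt, [Prog o M0])
  | SkipBack, Prog o MS => Some (SkipFwd true, Rt, [Prog o M0])
  | SkipBack, _ => Some (SkipBack, Lt, [a])
  | SkipFwd b, Prog o MIP => Some (if b then Fetch else Skip, Rt, [Prog o M0])
  | SkipFwd _, _ => Some (q, Rt, [a])
  | _, _ => None
  end.

(* (q, L, R): the head is on the first symbol of R, and L is the reversed tape to its left. *)
Definition config := (state * list sym * list sym)%type.

(** In [step_L] a longer word is allowed only at the right end of the tape, where it cannot overlap
    other symbols. *)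
Inductive step : config -> config -> Prop :=
| step_R q q' L a c R :
    delta q a = Some (q', Rt, [c]) -> step (q, L, a :: R) (q', c :: L, R)
| step_S q q' L a c R :
    delta q a = Some (q', St, [c]) -> step (q, L, a :: R) (q', L, c :: R)
| step_L q q' L a b w R :
    delta q a = Some (q', Lt, w) -> length w = 1 \/ R = [] ->
    step (q, b :: L, a :: R) (q', L, b :: w ++ R).

Inductive steps : config -> config -> Prop :=
| steps_refl c : steps c c
| steps_cons c d e : step c d -> steps d e -> steps c e.

Lemma steps_trans c d e : steps c d -> steps d e -> steps c e.
Proof. induction 1; eauto using steps. Qed.

(** * Sweeps of the head over the tape *)

Definition passes (d : dir) (q : state) (u : list sym) : Prop :=
  forall a, In a u -> delta q a = Some (q, d, [a]).

Lemma go_right q q' a c u L R :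
  delta q a = Some (q', Rt, [c]) -> passes Rt q' u ->
  steps (q, L, a :: u ++ R) (q', rev u ++ c :: L, R).
Proof.
  intros H Hu. eapply steps_cons; [apply step_R, H|]. clear H. generalize (c :: L) as K.
  induction u as [|b u IH]; intros K; simpl; [constructor|].
  eapply steps_cons; [apply step_R, Hu; now left|]. rewrite <- app_assoc.
  apply IH. intros x Hx. apply Hu. now right.
Qed.

Lemma sweep_left q y v b L R :
  passes Lt q (y :: v) -> steps (q, v ++ b :: L, y :: R) (q, L, b :: rev v ++ y :: R).
Proof.
  revert y R. induction v as [|z v IH]; intros y R Hv; simpl;
    (eapply steps_cons; [apply (step_L q q _ y _ [y] R); auto; apply Hv; now left|]).
  - constructor.
  - rewrite <- app_assoc. apply IH. intros x Hx. apply Hv. now right.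
Qed.

Lemma go_left q q' a w u b L R :
  delta q a = Some (q', Lt, w) -> (length w = 1 \/ R = []) -> passes Lt q' u ->
  steps (q, rev u ++ b :: L, a :: R) (q', L, b :: u ++ w ++ R).
Proof.
  intros H Hw Hu. rewrite <- (rev_involutive u) at 2.
  assert (Hv : passes Lt q' (rev u)) by (intros x Hx%in_rev; now apply Hu).
  destruct (rev u) as [|z v]; simpl; (eapply steps_cons; [apply step_L; eauto|]).
  - constructor.
  - rewrite <- app_assoc. now apply sweep_left.
Qed.

(** * Layout of the program text and the memory *)

Definition ptext (t : list op) : list sym := map (fun o => Prog o M0) t.
Definition cells (l : list (option bool)) : list sym := map Cell l.
Definition flat (bs : list (list bool)) : list (option bool) :=
  flat_map (fun b => None :: map Some b) bs.
Definition memory (bls : list (list bool)) (blk : list bool) (brs : list (list bool)) : list sym :=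
  cells (flat bls) ++ Ptr :: cells (map Some blk ++ flat brs) ++ [End].
Definition ones (b : list bool) : nat := count_occ bool_dec b true.

(** The pointer stands at register [p]. The default [[]] gives value 0 to all registers beyond the
    finitely many blocks on the tape. *)
Definition mem_rep (p : nat) (f : nat -> nat) (d : list sym) : Prop :=
  exists bls blk brs, d = memory bls blk brs /\ length bls = p /\
    forall j, f j = ones (nth j (bls ++ blk :: brs) []).

Lemma passes_app d q u v : passes d q u -> passes d q v -> passes d q (u ++ v).
Proof. intros H1 H2 a [Ha|Ha]%in_app_iff; auto. Qed.

Lemma passes_cons d q a u : delta q a = Some (q, d, [a]) -> passes d q u -> passes d q (a :: u).
Proof. intros H1 H2 b [<-|Hb]; auto. Qed.

Lemma passes_nil d q : passes d q [].
Proof. intros a []. Qed.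

Lemma passes_ptext d q t :
  (forall o, delta q (Prog o M0) = Some (q, d, [Prog o M0])) -> passes d q (ptext t).
Proof. intros H a (o & <- & _)%in_map_iff. apply H. Qed.

Lemma passes_cells d q l :
  (forall c, delta q (Cell c) = Some (q, d, [Cell c])) -> passes d q (cells l).
Proof. intros H a (o & <- & _)%in_map_iff. apply H. Qed.

Lemma passes_bits d q l :
  (forall c, delta q (Cell (Some c)) = Some (q, d, [Cell (Some c)])) ->
  passes d q (cells (map Some l)).
Proof. intros H a (o & <- & (x & <- & _)%in_map_iff)%in_map_iff. apply H. Qed.

Ltac pass := repeat first
  [ apply passes_nil | apply passes_app | apply passes_cons; [reflexivity|]
  | apply passes_ptext; now intros | apply passes_bits; now intros
  | apply passes_cells; now intros ].

Ltac norm := unfold memory, flat, cells;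
  repeat (rewrite ?map_app, ?flat_map_app, ?rev_app_distr, ?app_nil_r, <- ?app_assoc; simpl).
Ltac norm_in H := unfold memory, flat, cells in H;
  repeat (rewrite ?map_app, ?flat_map_app, ?rev_app_distr, ?app_nil_r, <- ?app_assoc in H; simpl in H).

(** * Execution of single instructions *)

Lemma seek o L ks lf D :
  o <> CLOSE ->
  steps (Fetch, L, Prog o M0 :: ptext ks ++ cells lf ++ Ptr :: D)
    (Seek o, rev (cells lf) ++ rev (ptext ks) ++ Prog o MIP :: L, Ptr :: D).
Proof.
  intros Ho. pose proof (go_right Fetch (Seek o) (Prog o M0) (Prog o MIP) (ptext ks ++ cells lf)
    L (Ptr :: D)) as H.
  norm_in H. apply H; [now destruct o|]. pass.
Qed.

(** The common end of the memory operations: the head runs left to the mark [MIP], clears it and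
    fetches the next instruction. *)
Lemma return_fetch q a w o u L R :
  delta q a = Some (Return, Lt, w) -> (length w = 1 \/ R = []) -> passes Lt Return u ->
  steps (q, rev u ++ Prog o MIP :: L, a :: R) (Fetch, Prog o M0 :: L, u ++ w ++ R).
Proof.
  intros H Hw Hu. eapply steps_trans; [eapply go_left; eauto|].
  eapply steps_cons; [apply step_R; reflexivity|]. constructor.
Qed.

(** Behind the last block [NextReg] meets [End] and opens a new empty block there. *)
Lemma run_MR L ks bls blk brs :
  exists b brs', (brs = b :: brs' \/ brs = [] /\ b = [] /\ brs' = []) /\
  steps (Fetch, L, Prog MR M0 :: ptext ks ++ memory bls blk brs)
        (Fetch, Prog MR M0 :: L, ptext ks ++ memory (bls ++ [blk]) b brs').
Proof.
  assert (S : steps (Fetch, L, Prog MR M0 :: ptext ks ++ memory bls blk brs)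
     (NextReg, rev (ptext ks ++ cells (flat bls) ++ Cell None :: cells (map Some blk)) ++
        Prog MR MIP :: L, cells (flat brs) ++ [End])).
  { unfold memory. eapply steps_trans; [now apply seek|].
    unfold cells. rewrite map_app, <- app_assoc.
    eapply steps_trans; [eapply go_right; [reflexivity|pass]|].
    norm. constructor. }
  destruct brs as [|b brs]; [exists [], []|exists b, brs].
  all: split; [auto|]; eapply steps_trans; [exact S|]; clear S; simpl.
  - eapply steps_trans; [apply return_fetch with (w := [Ptr; End]); [reflexivity|auto|pass]|].
    norm. constructor.
  - eapply steps_trans; [apply return_fetch with (w := [Ptr]); [reflexivity|auto|pass]|].
    norm. constructor.
Qed.

Lemma run_ML L ks bls b blk brs :
  steps (Fetch, L, Prog ML M0 :: ptext ks ++ memory (bls ++ [b]) blk brs)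
        (Fetch, Prog ML M0 :: L, ptext ks ++ memory bls b (blk :: brs)).
Proof.
  unfold memory. eapply steps_trans; [now apply seek|].
  pose proof (go_left (Seek ML) PrevReg Ptr [Cell None] (cells (map Some b)) (Cell None)) as G.
  pose proof (return_fetch PrevReg (Cell None) [Ptr] ML (ptext ks ++ cells (flat bls)) L) as H.
  norm_in G. norm_in H. norm.
  eapply steps_trans; [apply G; [reflexivity|auto|pass]|].
  eapply steps_trans; [apply H; [reflexivity|auto|pass]|].
  norm. constructor.
Qed.

(** The state carries the symbol displaced from the cell just left, so a single sweep to [End]
    shifts the rest of the memory by one cell. *)
Lemma run_insert c l u o L :
  passes Lt Return u ->
  steps (Insert c, rev u ++ Prog o MIP :: L, cells l ++ [End])
    (Fetch, Prog o M0 :: L, u ++ cells (c :: l) ++ [End]).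
Proof.
  revert c u. induction l as [|d l IH]; intros c u Hu.
  - eapply steps_trans; [apply return_fetch; [reflexivity|auto|pass; auto]|]. constructor.
  - simpl. eapply steps_cons; [apply step_R; reflexivity|].
    (* The cell just written joins the part over which the head will return. *)
    specialize (IH d (u ++ [Cell c])). norm_in IH. apply IH. pass; auto.
Qed.

Lemma run_INC L ks bls blk brs :
  steps (Fetch, L, Prog INC M0 :: ptext ks ++ memory bls blk brs)
        (Fetch, Prog INC M0 :: L, ptext ks ++ memory bls (true :: blk) brs).
Proof.
  unfold memory. eapply steps_trans; [now apply seek|].
  eapply steps_cons; [apply step_R; reflexivity|].
  pose proof (run_insert (Some true) (map Some blk ++ flat brs)
    (ptext ks ++ cells (flat bls) ++ [Ptr]) INC L) as H.
  norm_in H. norm. apply H. pass.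
Qed.

Definition zeros (z : nat) : list sym := cells (map Some (repeat false z)).

(** Locates the cell at which [Decr] and [Test] stop, the first one that is not false: either a one
    of the current block or, at value 0, the symbol following the block. *)
Lemma block_split blk brs : exists z a R,
  cells (map Some blk ++ flat brs) ++ [End] = zeros z ++ a :: R /\
  ((exists b, blk = repeat false z ++ true :: b /\ a = Cell (Some true) /\
              R = cells (map Some b ++ flat brs) ++ [End]) \/
   ones blk = 0 /\ (a = Cell None \/ a = End)).
Proof.
  induction blk as [|[|] blk (z & a & R & E & H)].
  - destruct brs as [|b brs]; [exists 0, End, []|eexists 0, (Cell None), _]; simpl; eauto.
  - eexists 0, (Cell (Some true)), _. split; [reflexivity|]. left. exists blk. auto.
  - exists (S z), a, R. simpl. rewrite E. split; auto.
    destruct H as [(b & -> & -> & ->)|[H1 H2]]; [left; exists b|]; auto.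
Qed.

Lemma ones_split_true z b : ones (repeat false z ++ true :: b) = S (ones b).
Proof. induction z; simpl; auto. Qed.

Lemma ones_split_false z b : ones (repeat false z ++ false :: b) = ones b.
Proof. induction z; simpl; auto. Qed.

Lemma passes_zeros d q z :
  delta q (Cell (Some false)) = Some (q, d, [Cell (Some false)]) -> passes d q (zeros z).
Proof.
  intros H a (c & <- & (b & <- & Hb%repeat_spec)%in_map_iff)%in_map_iff. now subst.
Qed.

Ltac pass ::= repeat first
  [ apply passes_nil | apply passes_app | apply passes_cons; [reflexivity|]
  | apply passes_zeros; reflexivity
  | apply passes_ptext; now intros | apply passes_bits; now intros
  | apply passes_cells; now intros ].

Lemma run_DEC L ks bls blk brs :
  exists blk', ones blk' = pred (ones blk) /\
  steps (Fetch, L, Prog DEC M0 :: ptext ks ++ memory bls blk brs)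
        (Fetch, Prog DEC M0 :: L, ptext ks ++ memory bls blk' brs).
Proof.
  destruct (block_split blk brs) as (z & a & R & E & H).
  assert (S : steps (Fetch, L, Prog DEC M0 :: ptext ks ++ memory bls blk brs)
     (Decr, rev (ptext ks ++ cells (flat bls) ++ Ptr :: zeros z) ++ Prog DEC MIP :: L, a :: R)).
  { unfold memory. eapply steps_trans; [now apply seek|]. rewrite E.
    eapply steps_trans; [eapply go_right; [reflexivity|pass]|].
    norm. constructor. }
  destruct H as [(b & -> & -> & ->)|[H1 H2]].
  - exists (repeat false z ++ false :: b). split; [now rewrite ones_split_true, ones_split_false|].
    eapply steps_trans; [exact S|].
    eapply steps_trans; [apply return_fetch; [reflexivity|auto|pass]|].
    unfold zeros. norm. constructor.
  - exists blk. split; [lia|].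
    eapply steps_trans; [exact S|].
    eapply steps_trans; [apply return_fetch with (w := [a]); [now destruct H2; subst|auto|pass]|].
    unfold memory. rewrite E. norm. constructor.
Qed.

(** The tape is cut at the cell [a] that decides the test; [u <> []] provides the symbol onto which
    the head steps left in [run_HALT]. *)
Lemma seek_test o L ks bls blk brs : o = OPEN \/ o = HALT ->
  exists u a R, passes Lt Return u /\ (forall b, passes Lt (ReturnTest b) u) /\
  u ++ a :: R = ptext ks ++ memory bls blk brs /\ u <> [] /\
  (if ones blk =? 0 then a = Cell None \/ a = End else a = Cell (Some true)) /\
  steps (Fetch, L, Prog o M0 :: ptext ks ++ memory bls blk brs)
        (Test o, rev u ++ Prog o MIP :: L, a :: R).
Proof.
  intros Ho. destruct (block_split blk brs) as (z & a & R & E & H).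
  exists (ptext ks ++ cells (flat bls) ++ Ptr :: zeros z), a, R.
  split; [pass|]. split; [intros; pass|]. unfold memory. rewrite E.
  split; [norm; reflexivity|].
  split; [intros X%(f_equal (@length _)); rewrite !length_app in X; simpl in X; lia|].
  split.
  - destruct H as [(b & -> & -> & _)|[-> H2]]; simpl; auto. now rewrite ones_split_true.
  - eapply steps_trans; [apply seek; now destruct Ho; subst|].
    eapply steps_trans; [eapply go_right with (q' := Test o); [now destruct Ho; subst|]|].
    + destruct Ho; subst; pass.
    + norm. constructor.
Qed.

Lemma run_OPEN L ks bls blk brs :
  steps (Fetch, L, Prog OPEN M0 :: ptext ks ++ memory bls blk brs)
    (if ones blk =? 0 then (Skip, Prog OPEN MS :: L, ptext ks ++ memory bls blk brs)
     else (Fetch, Prog OPEN ME :: L, ptext ks ++ memory bls blk brs)).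
Proof.
  destruct (seek_test OPEN L ks bls blk brs) as (u & a & R & _ & Hu & <- & _ & Ha & S); auto.
  eapply steps_trans; [exact S|].
  destruct (ones blk =? 0);
    (eapply steps_trans; [apply go_left with (w := [a]); [|now left|apply Hu]|]).
  1: destruct Ha; subst; reflexivity. 2: subst; reflexivity.
  all: eapply steps_cons; [apply step_R; reflexivity|]; constructor.
Qed.

Lemma run_HALT L ks bls blk brs : exists L' R',
  steps (Fetch, L, Prog HALT M0 :: ptext ks ++ memory bls blk brs)
    (if ones blk =? 0 then Accept else Reject, L', R').
Proof.
  destruct (seek_test HALT L ks bls blk brs) as (u & a & R & _ & _ & _ & Hu & Ha & S); auto.
  destruct (rev u) as [|b v] eqn:E.
  { apply (f_equal (@rev _)) in E. rewrite rev_involutive in E. now simpl in E. }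
  exists (v ++ Prog HALT MIP :: L), (b :: [a] ++ R).
  eapply steps_trans; [exact S|].
  eapply steps_cons; [|constructor]. simpl. apply step_L with (w := [a]); auto.
  destruct (ones blk =? 0); [destruct Ha|]; subst; reflexivity.
Qed.

(** * Execution of program texts *)

Lemma nth_ones_upd v (f g : nat -> nat) bls blk blk' brs :
  (forall j, f j = ones (nth j (bls ++ blk :: brs) [])) -> ones blk' = v ->
  (forall r, g r = upd f (length bls) v r) ->
  forall j, g j = ones (nth j (bls ++ blk' :: brs) []).
Proof.
  intros Hf Hv Hg j. rewrite Hg. unfold upd.
  destruct (Nat.eqb_spec j (length bls)) as [->|Hj].
  - now rewrite nth_middle.
  - rewrite Hf. destruct (Nat.lt_ge_cases j (length bls)).
    + now rewrite !app_nth1 by auto.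
    + rewrite !app_nth2 by auto. now replace (j - length bls) with (S (j - S (length bls))) by lia.
Qed.

(** Executions compose because the tape on the left and the text that follows are arbitrary, and
    because the executed text is left unmarked. *)
Definition does (t : list op) p f p' f' : Prop :=
  forall L ks d, mem_rep p f d -> exists d', mem_rep p' f' d' /\
    steps (Fetch, L, ptext t ++ ptext ks ++ d) (Fetch, rev (ptext t) ++ L, ptext ks ++ d').

Lemma does_nil p f : does [] p f p f.
Proof. intros L ks d H. exists d. split; auto. constructor. Qed.

Lemma does_app s t p f p' f' p'' f'' :
  does s p f p' f' -> does t p' f' p'' f'' -> does (s ++ t) p f p'' f''.
Proof.
  unfold does, ptext. intros Hs Ht L ks d H. rewrite map_app, rev_app_distr, <- !app_assoc.
  destruct (Hs L (t ++ ks) d H) as (d1 & H1 & S1). rewrite map_app, <- !app_assoc in S1.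
  destruct (Ht (rev (ptext s) ++ L) ks d1 H1) as (d2 & H2 & S2).
  exists d2. split; auto. eapply steps_trans; eauto.
Qed.

Lemma does_MR p f : does [MR] p f (S p) f.
Proof.
  intros L ks d (bls & blk & brs & -> & <- & Hf).
  destruct (run_MR L ks bls blk brs) as (b & brs' & Hb & S).
  eexists. split; [|exact S]. exists (bls ++ [blk]), b, brs'.
  split; auto. rewrite length_app. split; [simpl; lia|].
  intros j. rewrite Hf, <- app_assoc. simpl.
  destruct Hb as [->|(-> & -> & ->)]; auto.
  (* A newly opened block is empty, in agreement with the default for absent registers. *)
  replace (bls ++ [blk; []]) with ((bls ++ [blk]) ++ [[]]) by now rewrite <- app_assoc.
  destruct (Nat.lt_ge_cases j (length (bls ++ [blk]))).
  - now rewrite (app_nth1 _ [[]]).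
  - rewrite (app_nth2 _ [[]]) by auto. rewrite (nth_overflow (bls ++ [blk])) by auto.
    now destruct (j - length (bls ++ [blk])) as [|[|]].
Qed.

Lemma does_ML p f : does [ML] (S p) f p f.
Proof.
  intros L ks d (bls & blk & brs & -> & Hl & Hf).
  destruct bls as [|b bls _] using rev_ind; [discriminate|].
  rewrite length_app in Hl. simpl in Hl.
  eexists. split; [|apply run_ML]. exists bls, b, (blk :: brs).
  split; auto. split; [lia|]. intros j. now rewrite Hf, <- app_assoc.
Qed.

Lemma does_INC p f g : (forall r, g r = upd f p (S (f p)) r) -> does [INC] p f p g.
Proof.
  intros Hg L ks d (bls & blk & brs & -> & <- & Hf).
  eexists. split; [|apply run_INC]. exists bls, (true :: blk), brs. repeat split; auto.
  apply (nth_ones_upd (S (f (length bls))) f g bls blk); auto. now rewrite Hf, nth_middle.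
Qed.

Lemma does_DEC p f g : (forall r, g r = upd f p (pred (f p)) r) -> does [DEC] p f p g.
Proof.
  intros Hg L ks d (bls & blk & brs & -> & <- & Hf).
  destruct (run_DEC L ks bls blk brs) as (blk' & Hb & S).
  eexists. split; [|exact S]. exists bls, blk', brs. repeat split; auto.
  apply (nth_ones_upd (pred (f (length bls))) f g bls blk); auto. now rewrite Hf, nth_middle.
Qed.

Lemma fetch_OPEN p f d L ks : mem_rep p f d ->
  steps (Fetch, L, Prog OPEN M0 :: ptext ks ++ d)
    (if f p =? 0 then (Skip, Prog OPEN MS :: L, ptext ks ++ d)
     else (Fetch, Prog OPEN ME :: L, ptext ks ++ d)).
Proof.
  intros (bls & blk & brs & -> & <- & Hf). rewrite Hf, nth_middle. apply run_OPEN.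
Qed.

Lemma fetch_HALT p f d L : mem_rep p f d -> exists L' R',
  steps (Fetch, L, Prog HALT M0 :: d) (if f p =? 0 then Accept else Reject, L', R').
Proof.
  intros (bls & blk & brs & -> & <- & Hf). rewrite Hf, nth_middle.
  apply (run_HALT L []).
Qed.

Definition at_reg (i : nat) (t : list op) : list op := repeat MR i ++ t ++ repeat ML i.

(** Commands start and end with the pointer at register 0. Since [OPEN] tests the current register,
    a loop body must start and end at register [i], hence the moves around [text c]. *)
Fixpoint text (c : wcmd) : list op :=
  match c with
  | WInc i => at_reg i [INC]
  | WDec i => at_reg i [DEC]
  | a ;; b => text a ++ text b
  | WWhile i c => at_reg i (OPEN :: (repeat ML i ++ text c ++ repeat MR i) ++ [CLOSE])
  end.

Lemma does_right i p f : does (repeat MR i) p f (i + p) f.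
Proof.
  revert p. induction i as [|i IH]; intros p; [apply does_nil|].
  apply (does_app [MR]) with (1 := does_MR p f). replace (S i + p) with (i + S p) by lia. apply IH.
Qed.

Lemma does_left i p f : does (repeat ML i) (i + p) f p f.
Proof.
  revert p. induction i as [|i IH]; intros p; [apply does_nil|].
  apply (does_app [ML]) with (1 := does_ML (i + p) f). apply IH.
Qed.

Lemma does_at_reg i t f f' : does t i f i f' -> does (at_reg i t) 0 f 0 f'.
Proof.
  intros H. pose proof (does_right i 0 f) as HR. pose proof (does_left i 0 f') as HL.
  rewrite Nat.add_0_r in *. eapply does_app; [apply HR|]. eapply does_app; eauto.
Qed.

Inductive balanced : list op -> Prop :=
| bal_nil : balanced []
| bal_app s t : balanced s -> balanced t -> balanced (s ++ t)
| bal_op o : o <> OPEN -> o <> CLOSE -> balanced [o]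
| bal_loop t : balanced t -> balanced (OPEN :: t ++ [CLOSE]).

Lemma balanced_repeat o i : o <> OPEN -> o <> CLOSE -> balanced (repeat o i).
Proof.
  intros. induction i; [constructor|]. apply (bal_app [o]); auto. now constructor.
Qed.

Lemma balanced_at_reg i t : balanced t -> balanced (at_reg i t).
Proof. intros H. repeat apply bal_app; auto; now apply balanced_repeat. Qed.

Lemma balanced_text c : balanced (text c).
Proof.
  induction c; simpl; [apply balanced_at_reg..|apply bal_app|apply balanced_at_reg]; auto.
  1, 2: now constructor.
  apply bal_loop. repeat apply bal_app; auto; now apply balanced_repeat.
Qed.

Lemma ptext_app s t : ptext (s ++ t) = ptext s ++ ptext t.
Proof. apply map_app. Qed.

(** The text between the brackets is unmarked, so the nearest [ME] or [MS] on the left belongs to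
    the matching bracket. [MS] ends the skip mode, [ME] continues it. *)
Lemma skip_end (b : bool) t L R :
  steps (Skip, rev (ptext t) ++ Prog OPEN (if b then MS else ME) :: L, Prog CLOSE M0 :: R)
    (if b then Fetch else Skip, Prog CLOSE M0 :: rev (ptext t) ++ Prog OPEN M0 :: L, R).
Proof.
  eapply steps_trans; [apply go_left with (w := [Prog CLOSE MIP]); [reflexivity|auto|pass]|].
  eapply steps_trans; [apply go_right with (q' := SkipFwd b) (c := Prog OPEN M0);
    [now destruct b|pass]|].
  eapply steps_cons; [apply step_R; reflexivity|].
  unfold ptext. norm. constructor.
Qed.

Lemma skip_balanced t : balanced t -> forall L R,
  steps (Skip, L, ptext t ++ R) (Skip, rev (ptext t) ++ L, R).
Proof.
  induction 1 as [|s t _ IHs _ IHt|o H1 H2|t _ IH]; intros L R.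
  - constructor.
  - unfold ptext in *. rewrite map_app, rev_app_distr, <- !app_assoc.
    eapply steps_trans; eauto.
  - eapply steps_cons; [apply step_R; now destruct o|constructor].
  - simpl app. eapply steps_cons; [apply step_R; reflexivity|].
    fold (ptext (t ++ [CLOSE])). rewrite ptext_app, <- app_assoc.
    eapply steps_trans; [apply IH|]. norm. apply (skip_end false).
Qed.

Lemma does_loop_exit i t f : balanced t -> f i = 0 -> does (OPEN :: t ++ [CLOSE]) i f i f.
Proof.
  unfold does. intros Ht Hi L ks d Hd. exists d. split; auto.
  pose proof (fetch_OPEN i f d L ((t ++ [CLOSE]) ++ ks) Hd) as S. rewrite Hi in S.
  simpl. fold (ptext (t ++ [CLOSE])). rewrite !ptext_app, <- !app_assoc in *.
  eapply steps_trans; [exact S|].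
  eapply steps_trans; [now apply skip_balanced|].
  eapply steps_trans; [apply (skip_end true)|]. norm. constructor.
Qed.

(** The executed body is unmarked, so [Back] stops at the bracket of this very loop. It clears the
    mark without moving, and the test is repeated. *)
Lemma does_loop_enter i t f g h :
  f i <> 0 -> does t i f i g -> does (OPEN :: t ++ [CLOSE]) i g i h ->
  does (OPEN :: t ++ [CLOSE]) i f i h.
Proof.
  unfold does, ptext. intros Hi Ht Hl L ks d Hd.
  destruct (Ht (Prog OPEN ME :: L) (CLOSE :: ks) d Hd) as (d1 & H1 & S1).
  destruct (Hl L ks d1 H1) as (d2 & H2 & S2).
  exists d2. split; auto.
  pose proof (fetch_OPEN i f d L ((t ++ [CLOSE]) ++ ks) Hd) as S.
  apply Nat.eqb_neq in Hi. rewrite Hi in S.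
  simpl. fold (ptext (t ++ [CLOSE])). simpl in S2. fold (ptext (t ++ [CLOSE])) in S2.
  rewrite !ptext_app, <- !app_assoc in *.
  eapply steps_trans; [exact S|]. eapply steps_trans; [exact S1|].
  eapply steps_trans; [|exact S2].
  eapply steps_trans; [apply go_left with (q' := Back) (w := [Prog CLOSE M0]);
    [reflexivity|auto|pass]|].
  eapply steps_cons; [apply step_S; reflexivity|]. norm. constructor.
Qed.

Definition body (i : nat) (c : wcmd) : list op := repeat ML i ++ text c ++ repeat MR i.

Lemma does_text c f f' : wexec c f f' -> does (text c) 0 f 0 f'.
Proof.
  (* The second conjunct strengthens the induction: an iteration resumes at the bracket with the
     pointer at [i], without the moves of [at_reg]. *)
  intros H. enough (does (text c) 0 f 0 f' /\
    match c with WWhile i c => does (OPEN :: body i c ++ [CLOSE]) i f i f' | _ => True end)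
    by tauto.
  assert (B : forall i c, balanced (body i c)).
  { intros. repeat apply bal_app; try now apply balanced_repeat. apply balanced_text. }
  induction H as [i f f' H|i f f' H|a b f g h _ [IH1 _] _ [IH2 _]|i c f H
                 |i c f g h H _ [IH1 _] _ [_ IH2]].
  1, 2, 3: split; auto.
  - apply does_at_reg, does_INC, H.
  - apply does_at_reg, does_DEC, H.
  - eapply does_app; eauto.
  - assert (does (OPEN :: body i c ++ [CLOSE]) i f i f) by now apply does_loop_exit.
    split; auto. now apply does_at_reg.
  - assert (does (OPEN :: body i c ++ [CLOSE]) i f i h).
    { apply does_loop_enter with g; auto.
      pose proof (does_left i 0 f) as HL. pose proof (does_right i 0 g) as HR.
      rewrite Nat.add_0_r in *. eapply does_app; [apply HL|]. eapply does_app; eauto. }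
    split; auto. now apply does_at_reg.
Qed.

(* The initial HALT is never executed: it only carries the mark to which [Return] leads at the start. *)
Definition prefix (t : list op) : list sym := Prog HALT MIP :: ptext (t ++ [HALT]) ++ [Ptr].

(** The input is in register 0 and the output in register 1, to which the appended [MR] leads; the
    final [HALT] then tests it. *)
Lemma run_program c n f :
  (forall r, r <> 0 -> f r = 0) -> f 0 = n ->
  forall y, runs c f (fun g => g 1 = y) ->
  exists L R, steps (Pave, rev (prefix (text c ++ [MR]) ++ repeat (Cell (Some true)) n), [End])
    (if y =? 0 then Accept else Reject, L, R).
Proof.
  intros Hf Hn y (g & Hg & <-). apply does_text in Hg.
  pose proof (does_app _ _ _ _ _ _ _ _ Hg (does_MR 0 g)) as D.
  set (t := text c ++ [MR]) in *.
  destruct (D [Prog HALT M0] [HALT] (memory [] (repeat true n) [])) as (d & Hd & S).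
  { exists [], (repeat true n), []. repeat split; auto. intros [|j]; simpl.
    - rewrite Hn. clear. induction n as [|n IH]; [reflexivity|]. now rewrite IH at 1.
    - rewrite Hf by lia. now destruct j. }
  destruct (fetch_HALT 1 g d (rev (ptext t) ++ [Prog HALT M0]) Hd) as (L & R & S').
  exists L, R. eapply steps_trans; [|exact S'].
  eapply steps_trans; [|exact S].
  pose proof (return_fetch Pave End [End] HALT
     (ptext (t ++ [HALT]) ++ Ptr :: cells (map Some (repeat true n))) [] []) as G.
  unfold prefix. replace (repeat (Cell (Some true)) n) with (cells (map Some (repeat true n)))
    by (unfold cells; now rewrite !map_repeat).
  rewrite ptext_app in *. norm_in G. norm.
  apply G; [reflexivity|auto|]. pass.
Qed.

(** * Particles on the line: the machine as a family of module elements *)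

Open Scope Z_scope.

Inductive species := Hd (q : state) | Sy (a : sym).

Definition ops := [MR; ML; INC; DEC; OPEN; CLOSE; HALT].
Definition opt_bools := [None; Some true; Some false].
Definition syms : list sym :=
  [Ptr; End] ++ map Cell opt_bools ++
  flat_map (fun o => map (Prog o) [M0; MIP; ME; MS]) ops.
Definition states : list state :=
  [Pave; Fetch; NextReg; PrevReg; Decr; Return; Back; Skip; SkipBack; Accept; Reject] ++
  map Seek ops ++ map Test ops ++ map Insert opt_bools ++
  map ReturnTest [true; false] ++ map SkipFwd [true; false].
Definition all_species : list species := map Hd states ++ map Sy syms.

Lemma species_dec (s s' : species) : {s = s'} + {s <> s'}.
Proof. repeat decide equality. Qed.

Lemma In_syms a : In a syms.
Proof. destruct a as [[] []|[[]|]| |]; cbn; tauto. Qed.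

Lemma In_states q : In q states.
Proof. destruct q as [| |[]| | |[[]|]| |[]| |[]| | | |[]| |]; cbn; tauto. Qed.

Fixpoint index (s : species) (l : list species) : nat :=
  match l with
  | [] => 0
  | s' :: l => if species_dec s s' then 0 else S (index s l)
  end.
Definition code (s : species) : nat := index s all_species.

Lemma index_lt s l : In s l -> (index s l < length l)%nat.
Proof.
  induction l as [|s' l IH]; [intros []|]. intros H. simpl.
  destruct (species_dec s s'); [lia|]. destruct H as [->|H]; [easy|]. apply IH in H. lia.
Qed.

Lemma nth_index s l d : In s l -> nth (index s l) l d = s.
Proof.
  induction l as [|s' l IH]; [intros []|]. intros H. simpl.
  destruct (species_dec s s'); [auto|]. destruct H as [->|H]; [easy|]. auto.
Qed.

Lemma In_all_species s : In s all_species.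
Proof.
  apply in_app_iff. destruct s; [left|right]; apply in_map; [apply In_states|apply In_syms].
Qed.

Lemma code_inj s s' : code s = code s' -> s = s'.
Proof.
  intros H. rewrite <- (nth_index s all_species s) by apply In_all_species.
  fold (code s). rewrite H. apply nth_index, In_all_species.
Qed.

Notation particle := (Z * species)%type.

Definition particle_dec (p p' : particle) : {p = p'} + {p <> p'}.
Proof. decide equality; [apply species_dec|apply Z.eq_dec]. Qed.

Notation mult := (count_occ particle_dec).

Fixpoint place (x : Z) (w : list sym) : list particle :=
  match w with [] => [] | a :: w => (x, Sy a) :: place (x + 1) w end.
Definition dirZ (d : dir) : Z := match d with Lt => -1 | St => 0 | Rt => 1 end.

(* Symbols may stay or vanish, which is harmless as a head needs a symbol to move; a head vanishes only in state [Accept]. *)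
Inductive rule : list particle * list particle -> Prop :=
| rule_move q a q' d w : delta q a = Some (q', d, w) ->
    rule ([(0, Hd q); (0, Sy a)], (dirZ d, Hd q') :: place 0 w)
| rule_stay a : rule ([(0, Sy a)], [(0, Sy a)])
| rule_vanish a : rule ([(0, Sy a)], [])
| rule_pave : rule ([(0, Hd Pave)], [(1, Hd Pave); (0, Sy (Cell (Some true)))])
| rule_accept : rule ([(0, Hd Accept)], []).

(** [rule] as a finite list, from which a finite generating set is formed. *)
Definition rules : list (list particle * list particle) :=
  flat_map (fun q => flat_map (fun a =>
    match delta q a with
    | Some (q', d, w) => [([(0, Hd q); (0, Sy a)], (dirZ d, Hd q') :: place 0 w)]
    | None => []
    end) syms) states ++
  map (fun a => ([(0, Sy a)], [(0, Sy a)])) syms ++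
  map (fun a => ([(0, Sy a)], [])) syms ++
  [([(0, Hd Pave)], [(1, Hd Pave); (0, Sy (Cell (Some true)))]); ([(0, Hd Accept)], [])].

Lemma rules_spec r : In r rules <-> rule r.
Proof.
  unfold rules. rewrite !in_app_iff, in_flat_map, !in_map_iff. split.
  - intros [(q & _ & H)|[(a & <- & _)|[(a & <- & _)|[<-|[<-|[]]]]]]; try constructor.
    apply in_flat_map in H as (a & _ & H).
    destruct (delta q a) as [[[q' d] w]|] eqn:E; [|easy].
    destruct H as [<-|[]]. now constructor.
  - intros [q a q' d w E|a|a| |].
    + left. exists q. split; [apply In_states|]. apply in_flat_map. exists a.
      split; [apply In_syms|]. rewrite E. now left.
    + right; left. exists a. split; auto. apply In_syms.
    + right; right; left. exists a. split; auto. apply In_syms.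
    + do 3 right. now left.
    + do 3 right. right. now left.
Qed.

(** * Rules as generators, solutions as finite lists of events *)

Definition at_time (t c : Z) (ps : list particle) : elem :=
  map (fun p => (fst p, t, code (snd p), c)) ps.
Definition elem_of (r : list particle * list particle) : elem :=
  at_time 0 1 (fst r) ++ at_time 1 (-1) (snd r).
Definition basis : list elem := map elem_of rules.

Lemma valid_at_time t c ps : valid (length all_species) (at_time t c ps).
Proof.
  apply Forall_forall. intros q (p & <- & _)%in_map_iff.
  apply index_lt, In_all_species.
Qed.

Lemma valid_basis : Forall (valid (length all_species)) basis.
Proof.
  apply Forall_forall. intros e (r & <- & _)%in_map_iff.
  apply Forall_app; split; apply valid_at_time.
Qed.

Definition shift (x : Z) (ps : list particle) : list particle :=
  map (fun p => (fst p + x, snd p)) ps.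

(* (x, t, r): the rule r applied at position x and time t *)
Definition event := (Z * Z * (list particle * list particle))%type.
Definition effect (e : event) : elem :=
  let '(x, t, (i, o)) := e in at_time t 1 (shift x i) ++ at_time (t + 1) (-1) (shift x o).
Definition legal (e : event) : Prop := rule (snd e).

Definition den_eq (l l' : elem) : Prop := forall a b n, den l a b n = den l' a b n.

Lemma den_app l l' a b n : den (l ++ l') a b n = den l a b n + den l' a b n.
Proof. induction l as [|[[[? ?] ?] ?] l IH]; simpl; [lia|]. rewrite IH. lia. Qed.

Lemma den_at_time_shift t c ps x u a b n :
  den (at_time t c ps) (a - x) (b - u) n = den (at_time (u + t) c (shift x ps)) a b n.
Proof.
  induction ps as [|[y s] ps IH]; simpl; [reflexivity|]. rewrite IH.
  replace (y =? a - x) with (y + x =? a) by lia.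
  now replace (t =? b - u) with (u + t =? b) by lia.
Qed.

Lemma den_effect x t r a b n :
  act x t (den (elem_of r)) a b n = den (effect (x, t, r)) a b n.
Proof.
  destruct r as [i o]. unfold act, elem_of, effect. cbn [fst snd].
  now rewrite !den_app, !den_at_time_shift, Z.add_0_r.
Qed.

(** A generator translated by [(x, t)] is the effect of its rule applied at position [x] and time
    [t]. *)
Lemma in_subsemimodule_events l :
  in_subsemimodule basis l <->
  exists T, Forall legal T /\ den_eq l (flat_map effect T).
Proof.
  unfold in_subsemimodule, den_eq. split.
  - intros (terms & HB & HE).
    enough (exists T, Forall legal T /\ forall a b x,
      fold_right (fun (t : Z * Z * elem) acc =>
        match t with (g1, g2, bi) => act g1 g2 (den bi) a b x + acc end) 0 terms =
      den (flat_map effect T) a b x) as (T & H1 & H2).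
    { exists T. split; auto. intros. now rewrite HE, H2. }
    clear HE. induction HB as [|[[x t] e] terms He _ (T & H1 & H2)].
    + exists []. split; auto.
    + apply in_map_iff in He as (r & E & Hr). cbn [snd] in E. subst e. exists ((x, t, r) :: T). split.
      * constructor; auto. now apply rules_spec.
      * intros. cbn [fold_right flat_map]. now rewrite H2, den_app, den_effect.
  - intros (T & H1 & H2).
    exists (map (fun e => (fst e, elem_of (snd e))) T). split.
    + apply Forall_map. eapply Forall_impl; [|exact H1].
      intros e He. apply (in_map elem_of), rules_spec, He.
    + intros a b n. rewrite H2. clear H1 H2.
      induction T as [|[[x t] r] T IH]; [reflexivity|].
      cbn [flat_map map fold_right fst snd]. now rewrite den_app, IH, den_effect.
Qed.

(** * Configurations as particle systems *)

Definition is_sym (p : particle) : Prop := exists a, snd p = Sy a.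

Lemma place_sym x w : Forall is_sym (place x w).
Proof. revert x. induction w; simpl; constructor; eauto. now eexists. Qed.

Lemma place_app x v w : place x (v ++ w) = place x v ++ place (x + Z.of_nat (length v)) w.
Proof.
  revert x. induction v as [|a v IH]; intros x; cbn [app place length].
  - now rewrite Z.add_0_r.
  - rewrite IH. do 3 f_equal. lia.
Qed.

Lemma shift_cons x y s l : shift x ((y, s) :: l) = (y + x, s) :: shift x l.
Proof. reflexivity. Qed.

Lemma shift_place x y w : shift x (place y w) = place (y + x) w.
Proof.
  revert y. induction w as [|a w IH]; intros y; simpl; [reflexivity|].
  rewrite IH. do 2 f_equal. lia.
Qed.

Lemma In_place x w p : In p (place x w) -> x <= fst p < x + Z.of_nat (length w).
Proof.
  revert x. induction w as [|a w IH]; intros x; [intros []|].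
  intros [<-|H]; cbn [length]; [simpl; lia|]. apply IH in H. lia.
Qed.

Definition tape (x : Z) (c : config) : list particle :=
  let '(_, L, R) := c in place x (rev L ++ R).
Definition head_of (x : Z) (c : config) : particle :=
  let '(q, L, _) := c in (x + Z.of_nat (length L), Hd q).

Lemma tape_split x q L a R :
  Permutation (tape x (q, L, a :: R)) ((x + Z.of_nat (length L), Sy a) ::
    place x (rev L) ++ place (x + Z.of_nat (length L) + 1) R).
Proof.
  unfold tape. rewrite place_app, length_rev. cbn [place].
  symmetry. apply Permutation_middle.
Qed.

(** A step is local: it replaces the head and the only symbol on its cell, and leaves the remaining
    symbols [S] in place. *)
Lemma step_particles x c c' : step c c' ->
  exists q L a R q' d w S, c = (q, L, a :: R) /\ delta q a = Some (q', d, w) /\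
    let y := x + Z.of_nat (length L) in
    Permutation (tape x c) ((y, Sy a) :: S) /\ Forall is_sym S /\
    (forall s, ~ In (y, s) S) /\
    head_of x c' = (y + dirZ d, Hd q') /\ Permutation (place y w ++ S) (tape x c').
Proof.
  intros H. destruct c as [[q L] [|a R]]; [now inversion H|].
  assert (E : exists q' d w, delta q a = Some (q', d, w) /\ (length w = 1%nat \/ R = []) /\
    head_of x c' = (x + Z.of_nat (length L) + dirZ d, Hd q') /\
    tape x c' = place x (rev L ++ w ++ R)).
  { inversion H as [? q' ? ? a' ? E|? q' ? ? a' ? E|? q' L' ? b w ? E Hw]; subst;
      do 3 eexists; (split; [exact E|]); unfold head_of, tape.
    - split; [now left|]. split; [cbn [length dirZ]; f_equal; lia|].
      simpl. now rewrite <- app_assoc.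
    - split; [now left|]. split; [cbn [dirZ]; f_equal; lia|]. reflexivity.
    - split; [exact Hw|]. split; [cbn [length dirZ]; f_equal; lia|].
      simpl. now rewrite <- app_assoc. }
  destruct E as (q' & d & w & E & Hw & Hh & Ht).
  exists q, L, a, R, q', d, w,
    (place x (rev L) ++ place (x + Z.of_nat (length L) + 1) R).
  split; [auto|]. split; [auto|]. split; [apply tape_split|].
  split; [apply Forall_app; split; apply place_sym|].
  split; [intros s [Hs|Hs]%in_app_iff; apply In_place in Hs;
    rewrite ?length_rev in Hs; simpl in Hs; lia|].
  split; [exact Hh|]. rewrite Ht, !place_app, length_rev, app_assoc.
  rewrite (Permutation_app_comm (place _ w)), <- app_assoc.
  apply Permutation_app_head.
  (* Either [w] has length one and [R] keeps its position, or [R] is empty. *)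
  destruct Hw as [->| ->]; reflexivity.
Qed.

(** * From accepting runs to solutions *)

Lemma den_perm l l' : Permutation l l' -> den_eq l l'.
Proof.
  intros H a b n. induction H as [|[[[? ?] ?] ?]|[[[? ?] ?] ?] [[[? ?] ?] ?]|]; simpl; lia.
Qed.

Lemma den_at_time_app t c ps ps' a b n :
  den (at_time t c (ps ++ ps')) a b n = den (at_time t c ps) a b n + den (at_time t c ps') a b n.
Proof. unfold at_time. now rewrite map_app, den_app. Qed.

Lemma den_at_time_opp t c ps a b n :
  den (at_time t (- c) ps) a b n = - den (at_time t c ps) a b n.
Proof.
  induction ps as [|p ps IH]; simpl; [lia|]. rewrite IH. destruct (_ && _)%bool; lia.
Qed.

Definition accepted (t : Z) (ps : list particle) : Prop :=
  exists T, Forall legal T /\ den_eq (at_time t 1 ps) (flat_map effect T).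

Lemma accepted_perm t ps ps' : Permutation ps ps' -> accepted t ps -> accepted t ps'.
Proof.
  intros H (T & H1 & H2). exists T. split; auto. intros a b n. rewrite <- H2.
  symmetry. now apply den_perm, Permutation_map.
Qed.

(** Symbols can be discarded by [rule_vanish] or carried to the next time by [rule_stay]. *)
Lemma symbols_effect t S : Forall is_sym S ->
  (exists T, Forall legal T /\ den_eq (at_time t 1 S) (flat_map effect T)) /\
  (exists T, Forall legal T /\
     den_eq (at_time t 1 S ++ at_time (t + 1) (-1) S) (flat_map effect T)).
Proof.
  induction 1 as [|[x s] S [a Ha] _ [(T1 & A1 & B1) (T2 & A2 & B2)]].
  - split; exists []; split; try constructor.
  - cbn [snd] in Ha. subst s. split.
    + exists ((x, t, ([(0, Sy a)], [])) :: T1). split; [constructor; auto; constructor|].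
      intros u v n. specialize (B1 u v n). simpl in *. lia.
    + exists ((x, t, ([(0, Sy a)], [(0, Sy a)])) :: T2). split; [constructor; auto; constructor|].
      intros u v n. specialize (B2 u v n). cbn [flat_map]. rewrite !den_app in *.
      rewrite <- B2. unfold effect. rewrite den_app. simpl. lia.
Qed.

(** While the rule fires, the symbols in [S] wait by [rule_stay]; the given events consume
    everything from time [t + 1] on. *)
Lemma accepted_rule t x i o S : rule (i, o) -> Forall is_sym S ->
  accepted (t + 1) (shift x o ++ S) -> accepted t (shift x i ++ S).
Proof.
  intros Hr HS (T & A & B). destruct (symbols_effect t S HS) as [_ (T' & A' & B')].
  exists ((x, t, (i, o)) :: T' ++ T). split.
  - constructor; auto. now apply Forall_app.
  - intros a b n. specialize (B a b n). specialize (B' a b n).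
    cbn [flat_map]. rewrite flat_map_app, !den_app, <- B, <- B'. unfold effect.
    rewrite !den_app, !den_at_time_app.
    change (-1) with (- (1)). rewrite !den_at_time_opp. lia.
Qed.

Lemma accepted_Accept t x S : Forall is_sym S -> accepted t ((x, Hd Accept) :: S).
Proof.
  intros HS. destruct (symbols_effect t S HS) as [(T & A & B) _].
  exists ((x, t, ([(0, Hd Accept)], [])) :: T). split; [constructor; auto; constructor|].
  intros a b n. specialize (B a b n). simpl in *. rewrite <- B. lia.
Qed.

Lemma tape_sym x c : Forall is_sym (tape x c).
Proof. destruct c as [[q L] R]. apply place_sym. Qed.

(** Each step takes one time unit; at [Accept] the head and all symbols vanish together. *)
Lemma accepted_steps x c c' : steps c c' -> fst (fst c') = Accept ->
  forall t, accepted t (head_of x c :: tape x c).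
Proof.
  induction 1 as [[[q L] R]|c d e Hs _ IH]; intros He t.
  - cbn in He. subst q. apply accepted_Accept, tape_sym.
  - destruct (step_particles x c d Hs)
      as (q & L & a & R & q' & dr & w & S & -> & E & P1 & HS & _ & Hh & P2).
    set (y := x + Z.of_nat (length L)) in *.
    apply accepted_perm with (shift y [(0, Hd q); (0, Sy a)] ++ S).
    { simpl. constructor. now rewrite P1. }
    apply accepted_rule with ((dirZ dr, Hd q') :: place 0 w); auto.
    { now constructor. }
    eapply accepted_perm; [|exact (IH He (t + 1))].
    rewrite Hh, <- P2. simpl. rewrite shift_place, Z.add_0_l, (Z.add_comm y). reflexivity.
Qed.

(** Each use of [rule_pave] takes one time unit and leaves one true cell, so a number is written in
    unary while [W] waits. *)
Lemma accepted_pave t x n W : Forall is_sym W ->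
  accepted (t + Z.of_nat n) ((x + Z.of_nat n, Hd Pave) :: place x (repeat (Cell (Some true)) n) ++ W) ->
  accepted t ((x, Hd Pave) :: W).
Proof.
  revert t x W. induction n as [|n IH]; intros t x W HW H.
  - now rewrite !Z.add_0_r in H.
  - apply (accepted_rule t x [(0, Hd Pave)] [(1, Hd Pave); (0, Sy (Cell (Some true)))]);
      [constructor|auto|].
    cbn [shift map app fst snd]. rewrite Z.add_0_l, (Z.add_comm 1).
    apply IH; [constructor; auto; now eexists|].
    replace (t + 1 + Z.of_nat n) with (t + Z.of_nat (S n)) by lia.
    replace (x + 1 + Z.of_nat n) with (x + Z.of_nat (S n)) by lia.
    eapply accepted_perm; [|exact H]. constructor. cbn [place repeat app].
    apply Permutation_middle.
Qed.

(** * From solutions to causal runs *)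

Definition ins_at (t : Z) (T : list event) : list particle :=
  flat_map (fun '(x, u, (i, o)) => if u =? t then shift x i else []) T.
Definition outs_at (t : Z) (T : list event) : list particle :=
  flat_map (fun '(x, u, (i, o)) => if u =? t then shift x o else []) T.

Lemma den_at_time t c ps b p :
  den (at_time t c ps) (fst p) b (code (snd p)) = if t =? b then c * Z.of_nat (mult ps p) else 0.
Proof.
  induction ps as [|[x s] ps IH]; simpl; [destruct (t =? b); lia|].
  rewrite IH. clear IH. destruct p as [y s']. cbn [fst snd].
  destruct (particle_dec (x, s) (y, s')) as [[= -> ->]|H].
  - rewrite Z.eqb_refl, Nat.eqb_refl, andb_true_r, Nat2Z.inj_succ. destruct (t =? b); simpl; lia.
  - destruct (Z.eqb_spec x y); [|reflexivity].
    destruct (Nat.eqb_spec (code s) (code s')) as [E%code_inj|]; [congruence|].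
    now rewrite andb_false_r.
Qed.

Lemma den_events T b p :
  den (flat_map effect T) (fst p) b (code (snd p)) =
  Z.of_nat (mult (ins_at b T) p) - Z.of_nat (mult (outs_at (b - 1) T) p).
Proof.
  induction T as [|[[x u] [i o]] T IH]; [reflexivity|].
  unfold ins_at, outs_at in *. cbn [flat_map effect].
  rewrite !den_app, IH, !den_at_time, !count_occ_app.
  replace (u + 1 =? b) with (u =? b - 1) by lia.
  destruct (u =? b), (u =? b - 1); simpl (mult [] p); lia.
Qed.

(** Comparison of coefficients at time [t]. As all multiplicities are natural numbers, the identity
    over the integers becomes one of multisets. *)
Lemma events_balance I T : den_eq (at_time 0 1 I) (flat_map effect T) ->
  forall t, Permutation (ins_at t T) ((if t =? 0 then I else []) ++ outs_at (t - 1) T).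
Proof.
  intros H t. apply (Permutation_count_occ particle_dec). intros p.
  specialize (H (fst p) t (code (snd p))).
  rewrite den_at_time, den_events in H. rewrite count_occ_app, (Z.eqb_sym t).
  destruct (0 =? t); simpl (mult [] p); lia.
Qed.

(** No rule has an empty left side, so nothing arises from nothing. *)
Lemma ins_nil t T : Forall legal T -> ins_at t T = [] -> outs_at t T = [].
Proof.
  induction 1 as [|[[x u] [i o]] T Hr _ IH]; [auto|].
  unfold ins_at, outs_at in *. cbn [flat_map]. intros [H1 H2]%app_eq_nil.
  rewrite IH by auto. destruct (u =? t); [|auto].
  exfalso. inversion Hr; subst; discriminate.
Qed.

(** With finitely many events, nothing happens before some time [m]; the balance carries this
    emptiness forward up to time 0. *)
Lemma events_start I T : Forall legal T -> den_eq (at_time 0 1 I) (flat_map effect T) ->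
  Permutation (ins_at 0 T) I.
Proof.
  intros HT HE. pose proof (events_balance I T HE) as B.
  assert (M : exists m, forall t, t < m -> ins_at t T = []).
  { clear. induction T as [|[[x u] [i o]] T [m IH]]; [exists 0; auto|].
    exists (Z.min m u). intros t Ht. unfold ins_at in *. cbn [flat_map].
    rewrite IH by lia. now destruct (Z.eqb_spec u t); [lia|]. }
  destruct M as [m Hm].
  assert (N : forall k t, t < m + Z.of_nat k -> t < 0 -> ins_at t T = []).
  { induction k as [|k IH]; intros t H1 H2; [apply Hm; lia|].
    specialize (B t). destruct (Z.eqb_spec t 0); [lia|].
    rewrite ins_nil in B; auto; [|apply IH; lia].
    now apply Permutation_sym, Permutation_nil in B. }
  specialize (B 0). rewrite (ins_nil (0 - 1)), app_nil_r in B; auto.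
  apply (N (Z.to_nat (0 - m))); lia.
Qed.

Lemma events_end T : exists m, forall t, m < t -> ins_at t T = [].
Proof.
  induction T as [|[[x u] [i o]] T [m IH]]; [exists 0; auto|].
  exists (Z.max m u). intros t Ht. unfold ins_at in *. cbn [flat_map].
  rewrite IH by lia. now destruct (Z.eqb_spec u t); [lia|].
Qed.

Definition sub (l l' : list particle) : Prop := forall p, (mult l p <= mult l' p)%nat.

Lemma sub_in l l' p : sub l l' -> In p l -> In p l'.
Proof.
  intros H Hp. apply (count_occ_In particle_dec) in Hp.
  apply (count_occ_In particle_dec). specialize (H p). lia.
Qed.

Lemma perm_mult l l' : Permutation l l' -> forall p, mult l p = mult l' p.
Proof. apply Permutation_count_occ. Qed.

Lemma shift_sym x l : Forall is_sym (shift x l) -> Forall is_sym l.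
Proof.
  unfold shift. rewrite Forall_map. intros H. eapply Forall_impl; [|exact H]. intros p [a Ha]. now exists a.
Qed.

(** The only rules that consume no head are [rule_stay] and [rule_vanish]. *)
Lemma passive t T : Forall legal T -> Forall is_sym (ins_at t T) ->
  Forall is_sym (outs_at t T) /\ sub (outs_at t T) (ins_at t T).
Proof.
  induction 1 as [|[[x u] [i o]] T Hr _ IH].
  - intros _. split; [constructor|]. intros p. reflexivity.
  - unfold ins_at, outs_at in *. cbn [flat_map]. intros [H1 H2]%Forall_app.
    destruct (IH H2) as [A B]. rewrite Forall_app.
    destruct (u =? t); [|split; [split; auto; constructor|exact B]].
    assert (C : Forall is_sym (shift x o) /\ sub (shift x o) (shift x i)).
    { inversion Hr as [? ? ? ? ? _ E|a E|a E|E|E]; cbn in E; subst;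
        try (apply shift_sym, Forall_inv in H1 as [? [=]]).
      - split; [constructor; [now exists a|constructor]|intros p; reflexivity].
      - split; [constructor|intros p; simpl; lia]. }
    destruct C as [C D]. split; [split; auto|].
    intros p. rewrite !count_occ_app. specialize (B p). specialize (D p). lia.
Qed.

(** [S] is only an upper bound for the symbols, since some may have vanished; the head occurs
    exactly once. *)
Definition inv (T : list event) (t x : Z) (q : state) (S : list particle) : Prop :=
  exists C, Permutation (ins_at t T) ((x, Hd q) :: C) /\ Forall is_sym C /\ sub C S.

(** Splits off an event that consumes the head. Once the other inputs [E] are known to be symbols,
    [passive] applies to them. *)
Lemma fire T t x q C : Forall legal T ->
  Permutation (ins_at t T) ((x, Hd q) :: C) -> Forall is_sym C ->
  exists y i o E D, rule (i, o) /\ In (x, Hd q) (shift y i) /\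
    Permutation ((x, Hd q) :: C) (shift y i ++ E) /\
    Permutation (outs_at t T) (shift y o ++ D) /\
    (Forall is_sym E -> Forall is_sym D /\ sub D E).
Proof.
  intros HT HP HC.
  assert (Hin : In (x, Hd q) (ins_at t T)) by (rewrite HP; now left).
  apply in_flat_map in Hin as ([[y u] [i o]] & He & Hin).
  destruct (Z.eqb_spec u t) as [->|]; [|easy].
  apply in_split in He as (T1 & T2 & ->).
  apply Forall_app in HT as [HT1 HT2]. inversion HT2 as [|? ? Hr HT3]; subst.
  exists y, i, o, (ins_at t (T1 ++ T2)), (outs_at t (T1 ++ T2)).
  split; [exact Hr|]. split; [exact Hin|].
  unfold ins_at, outs_at in *. rewrite !flat_map_app in *. cbn [flat_map] in *.
  rewrite Z.eqb_refl in *. split; [|split].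
  - rewrite <- HP. apply Permutation_app_swap_app.
  - apply Permutation_app_swap_app.
  - rewrite <- !flat_map_app. apply passive. now apply Forall_app.
Qed.

(** The rule that consumes the head decides what happens. A move needs its symbol on the cell of the
    head, hence in [S], so vanished symbols can block a run but never create a new one. *)
Lemma inv_next I T t x q S : Forall legal T -> den_eq (at_time 0 1 I) (flat_map effect T) ->
  0 <= t -> inv T t x q S ->
  q = Accept \/
  (q = Pave /\ inv T (t + 1) (x + 1) Pave ((x, Sy (Cell (Some true))) :: S)) \/
  (exists a q' d w, delta q a = Some (q', d, w) /\ In (x, Sy a) S /\
    forall S', Permutation S ((x, Sy a) :: S') ->
      inv T (t + 1) (x + dirZ d) q' (place x w ++ S')).
Proof.
  intros HT HE Ht (C & HP & HC & HS).
  destruct (fire T t x q C HT HP HC) as (y & i & o & E & D & Hr & Hin & P1 & P2 & HD).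
  pose proof (events_balance I T HE (t + 1)) as B.
  (* After time 0 no initial particles enter: what is consumed at [t + 1] was produced at [t]. *)
  destruct (Z.eqb_spec (t + 1) 0); [lia|]. replace (t + 1 - 1) with t in B by lia.
  simpl in B. rewrite P2 in B.
  inversion Hr as [q0 a q' d w Hd X|a X|a X|X|X]; subst; cbn in Hin.
  - destruct Hin as [[= X1 X2]|[|[]]]; [|discriminate]. subst q0. rewrite X1 in *.
    rewrite !shift_cons, ?Z.add_0_l in P1, B. rewrite shift_place, Z.add_0_l in B.
    cbn [shift map app] in P1, B.
    apply Permutation_cons_inv in P1.
    rewrite P1 in HC.
    apply Forall_inv_tail in HC. destruct (HD HC) as [D1 D2].
    right; right. exists a, q', d, w. split; [auto|]. split.
    + apply (sub_in C); auto. rewrite P1. now left.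
    + intros S' PS. exists (place x w ++ D).
      rewrite (Z.add_comm x). split; [exact B|]. split.
      * apply Forall_app. split; [apply place_sym|auto].
      * intros p. rewrite !count_occ_app. specialize (D2 p). specialize (HS p).
        rewrite (perm_mult _ _ PS), (perm_mult _ _ P1) in HS. simpl in HS.
        destruct (particle_dec _ _); lia.
  - destruct Hin as [[= X1 X2]|[]].
  - destruct Hin as [[= X1 X2]|[]].
  - destruct Hin as [[= X1 X2]|[]]. subst q. 
    rewrite X1, !shift_cons, ?Z.add_0_l in P1, B. cbn [shift map app] in P1, B.
    apply Permutation_cons_inv in P1.
    rewrite P1 in HC.
    destruct (HD HC) as [D1 D2].
    right; left. split; auto. exists ((x, Sy (Cell (Some true))) :: D).
    rewrite (Z.add_comm x). split; [exact B|]. split.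
    + constructor; auto. now eexists.
    + intros p. specialize (D2 p). specialize (HS p). rewrite (perm_mult _ _ P1) in HS.
      simpl. destruct (particle_dec _ _); lia.
  - destruct Hin as [[= X1 X2]|[]]. subst q. now left.
Qed.

Lemma inv_perm T t x q S S' : Permutation S S' -> inv T t x q S -> inv T t x q S'.
Proof.
  intros H (C & H1 & H2 & H3). exists C. repeat split; auto.
  intros p. rewrite <- (perm_mult _ _ H). apply H3.
Qed.

Definition inv_config (T : list event) (t x : Z) (c : config) : Prop :=
  let '(q, L, _) := c in inv T t (x + Z.of_nat (length L)) q (tape x c).

(** The cell of the head holds only one symbol and [delta] is a function, so apart from [rule_pave]
    only the step of the machine is possible. *)
Lemma inv_step I T t x c c' : Forall legal T -> den_eq (at_time 0 1 I) (flat_map effect T) ->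
  0 <= t -> inv_config T t x c -> step c c' ->
  let y := fst (head_of x c) in
  (fst (fst c) = Pave /\ inv T (t + 1) (y + 1) Pave ((y, Sy (Cell (Some true))) :: tape x c)) \/
  inv_config T (t + 1) x c'.
Proof.
  intros HT HE Ht Hi Hs.
  destruct (step_particles x c c' Hs)
    as (q & L & a & R & q' & d & w & S & -> & E & P1 & _ & HS & Hh & P2).
  destruct (inv_next I T t _ _ _ HT HE Ht Hi) as [->|[[-> H]|(b & r & e & v & Hd & Hb & H)]].
  - now destruct a.
  - left. split; [reflexivity|exact H].
  - right. rewrite P1 in Hb. destruct Hb as [[= <-]|Hb]; [|now apply HS in Hb].
    rewrite E in Hd. injection Hd as <- <- <-.
    apply H in P1. eapply inv_perm in P1; [|exact P2].
    destruct c' as [[q1 L1] R1]. injection Hh as E1 E2. unfold inv_config.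
    rewrite E1, E2. exact P1.
Qed.

Lemma delta_not_Pave q a d w : delta q a <> Some (Pave, d, w).
Proof.
  destruct q as [| |[]| | |[[]|]| |[]| |[]| | | |[]| |], a as [[] []|[[]|]| |]; discriminate.
Qed.

Lemma step_not_Pave c c' : step c c' -> fst (fst c') <> Pave.
Proof. destruct 1; cbn; intros ->; eapply delta_not_Pave; eassumption. Qed.

(** A solution would have to follow the run up to [Reject], where no rule consumes the head. No
    transition enters [Pave], which excludes [rule_pave] on the way. *)
Lemma inv_reject I T x c c' : Forall legal T -> den_eq (at_time 0 1 I) (flat_map effect T) ->
  steps c c' -> fst (fst c') = Reject -> fst (fst c) <> Pave ->
  forall t, 0 <= t -> ~ inv_config T t x c.
Proof.
  intros HT HE. induction 1 as [[[q L] R]|c d e Hs _ IH]; intros Hr Hp t Ht Hi.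
  - cbn in Hr. subst q.
    destruct (inv_next I T t _ _ _ HT HE Ht Hi) as [|[[? _]|(b & r & d & w & Hd & _)]];
      discriminate.
  - destruct (inv_step I T t x c d HT HE Ht Hi Hs) as [[? _]|H]; [easy|].
    apply (IH Hr (step_not_Pave _ _ Hs) (t + 1)); [lia|exact H].
Qed.

(* A paving head that has passed [End] paves forever. *)
Lemma no_endless_pave I T t S : Forall legal T -> den_eq (at_time 0 1 I) (flat_map effect T) ->
  0 <= t -> inv T t t Pave S -> (forall y, In (y, Sy End) S -> y < t) -> False.
Proof.
  intros HT HE Ht Hi HS.
  (* Paving advances one cell per time unit, so position and time stay equal and [End] stays
     behind. *)
  assert (G : forall k, exists S, inv T (t + Z.of_nat k) (t + Z.of_nat k) Pave S /\
     forall y, In (y, Sy End) S -> y < t + Z.of_nat k).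
  { induction k as [|k (S' & H1 & H2)].
    - exists S. now rewrite Z.add_0_r.
    - replace (t + Z.of_nat (Datatypes.S k)) with (t + Z.of_nat k + 1) by lia.
      destruct (inv_next I T (t + Z.of_nat k) _ _ _ HT HE ltac:(lia) H1)
        as [|[[_ H]|(b & r & d & w & Hd & Hb & _)]]; [discriminate| |].
      + eexists. split; [exact H|]. intros y [|Hy]; [discriminate|]. apply H2 in Hy. lia.
      + destruct b; try discriminate. apply H2 in Hb. lia. }
  (* The paving would outlast the last event. *)
  destruct (events_end T) as [m Hm].
  destruct (G (Z.to_nat (m + 1))) as (S' & (C & HC & _) & _).
  rewrite Hm in HC by lia. now apply Permutation_nil in HC.
Qed.

(** * Inputs and the paving phase *)

Definition start (t : list op) : list particle :=
  (0, Hd Pave) :: place (- Z.of_nat (length (prefix t))) (prefix t).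
(** The prefix ends with [Ptr] at position -1, so paving from 0 up to [End] fills the block of
    register 0 with [n] ones. *)
Definition input (t : list op) (n : nat) : list particle := (Z.of_nat n, Sy End) :: start t.

Definition paved (t : list op) (n : nat) : config :=
  (Pave, rev (prefix t ++ repeat (Cell (Some true)) n), [End]).

Lemma paved_head t n :
  head_of (- Z.of_nat (length (prefix t))) (paved t n) = (Z.of_nat n, Hd Pave).
Proof.
  cbn [head_of paved]. rewrite length_rev, length_app, repeat_length. f_equal. lia.
Qed.

Lemma paved_tape t n :
  Permutation (place 0 (repeat (Cell (Some true)) n) ++ (Z.of_nat n, Sy End) ::
     place (- Z.of_nat (length (prefix t))) (prefix t))
    (tape (- Z.of_nat (length (prefix t))) (paved t n)).
Proof.
  cbn [tape paved]. rewrite rev_involutive, <- app_assoc, !place_app, repeat_length.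
  cbn [place]. rewrite Z.add_opp_diag_l, Z.add_0_l.
  rewrite <- Permutation_middle, Permutation_app_comm.
  rewrite app_assoc. apply Permutation_cons_append.
Qed.

Lemma in_basis_events t n :
  in_subsemimodule basis ((Z.of_nat n, 0, code (Sy End), 1) :: at_time 0 1 (start t)) <->
  accepted 0 (input t n).
Proof. apply in_subsemimodule_events. Qed.

Lemma input_accepted t n L R : steps (paved t n) (Accept, L, R) -> accepted 0 (input t n).
Proof.
  intros H. unfold input, start. eapply accepted_perm; [apply perm_swap|].
  apply (accepted_pave 0 0 n).
  - constructor; [now eexists|apply place_sym].
  - pose proof (accepted_steps (- Z.of_nat (length (prefix t))) _ _ H eq_refl (Z.of_nat n)) as G.
    rewrite paved_head in G. rewrite Z.add_0_l.
    eapply accepted_perm; [|exact G]. constructor. now rewrite paved_tape.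
Qed.

(** A solution must pave up to position [n]. There it either passes [End] and paves forever, or
    turns around and follows the rejecting run. *)
Lemma input_rejected t n L R : steps (paved t n) (Reject, L, R) -> ~ accepted 0 (input t n).
Proof.
  intros H (T & HT & HE).
  set (o := - Z.of_nat (length (prefix t))).
  set (W := (Z.of_nat n, Sy End) :: place o (prefix t)).
  (* Neither the paved cells nor the prefix contain [End]. *)
  assert (Wend : forall y k, In (y, Sy End) (place 0 (repeat (Cell (Some true)) k) ++ W) ->
     y = Z.of_nat n).
  { intros y k [Hy|[[=]|Hy]]%in_app_iff; auto; exfalso.
    - revert Hy. generalize 0. induction k as [|k IH]; intros z; [easy|].
      intros [|Hy]; [discriminate|]. now apply IH in Hy.
    - revert Hy. generalize o. unfold prefix. cbn [place]. intros z [|Hy]; [discriminate|].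
      rewrite place_app in Hy. apply in_app_iff in Hy as [Hy|[|[]]]; [|discriminate].
      revert Hy. generalize (z + 1). unfold ptext.
      induction (t ++ [HALT]) as [|a s IH]; intros u; [easy|].
      intros [|Hy]; [discriminate|]. now apply IH in Hy. }
  (* [End] is the only symbol on which a paving head can move, and it is not met before position
     [n]. *)
  assert (P : forall k, (k <= n)%nat -> inv T (Z.of_nat k) (Z.of_nat k) Pave
     (place 0 (repeat (Cell (Some true)) k) ++ W)).
  { induction k as [|k IH]; intros Hk.
    - exists W. pose proof (events_start _ _ HT HE) as G. split; [|split].
      + rewrite G. apply perm_swap.
      + constructor; [now eexists|apply place_sym].
      + intros p. reflexivity.
    - destruct (inv_next _ T _ _ _ _ HT HE (Nat2Z.is_nonneg k) (IH ltac:(lia)))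
        as [|[[_ G]|(b & r & d & w & Hd & Hb & _)]]; [discriminate| |].
      + rewrite Nat2Z.inj_succ. eapply inv_perm; [|exact G].
        change (repeat (Cell (Some true)) (S k))
          with (Cell (Some true) :: repeat (Cell (Some true)) k).
        rewrite repeat_cons, place_app, repeat_length, <- app_assoc.
        apply Permutation_middle.
      + destruct b; try discriminate. apply Wend in Hb. lia. }
  specialize (P n (Nat.le_refl n)).
  assert (Hi : inv_config T (Z.of_nat n) o (paved t n)).
  { pose proof (f_equal fst (paved_head t n)) as E. cbn [fst head_of paved] in E. fold o in E.
    unfold inv_config, paved. rewrite E. eapply inv_perm; [apply paved_tape|]. exact P. }
  inversion H as [|? d ? Hs Hd]; subst.
  destruct (inv_step _ _ _ _ _ _ HT HE (Nat2Z.is_nonneg n) Hi Hs) as [[_ G]|G].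
  - unfold o in G. rewrite paved_head in G. cbn [fst] in G.
    eapply no_endless_pave; [exact HT|exact HE| |exact G|]; [lia|].
    intros y [|Hy]; [discriminate|]. rewrite <- paved_tape in Hy. apply Wend in Hy. lia.
  - eapply (inv_reject _ _ _ _ _ HT HE Hd eq_refl); [| |exact G]; [|lia].
    now apply step_not_Pave in Hs.
Qed.

(** * Diagonalisation *)

Definition self_text (p : rcode) (x : nat) : list op :=
  text (comp (RComp p [rself x]) [0%nat] 1 2) ++ [MR].

(** [rself x] turns the code of [l] into that of [l] extended by an entry at position [enc_elem l],
    and [p] is run on the result. Output 0 leads to acceptance. *)
Lemma run_self p x l y :
  reval p [enc_elem ((Z.of_nat (enc_elem l), 0, x, 1) :: l)] y ->
  exists L R, steps (paved (self_text p x) (enc_elem l))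
    (if Nat.eqb y 0 then Accept else Reject, L, R).
Proof.
  intros Hy.
  assert (Hq : reval (RComp p [rself x]) [enc_elem l] y).
  { apply ev_comp with (2 := Hy). constructor; [apply reval_rself|constructor]. }
  set (f := upd (fun _ => 0%nat) 0 (enc_elem l)).
  apply (run_program _ _ f).
  - intros [|r] Hr; [easy|reflexivity].
  - reflexivity.
  - eapply runs_weaken; [apply (comp_correct _ _ _ Hq [0%nat] 1%nat 2%nat f)|].
    + reflexivity.
    + repeat constructor.
    + intros [|[]]; discriminate.
    + constructor.
    + intros g [Hg _]. exact Hg.
Qed.

Theorem theorem1 :
  exists (k : nat) (B : list elem),
    Forall (valid k) B /\
    ~ exists p : rcode, decides k (in_subsemimodule B) p.
Proof.
  exists (length all_species), basis. split; [apply valid_basis|].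
  intros [p Hp].
  (* The text depends only on [p] and a fixed species, so forming [l] and its code from it is not
     circular. *)
  pose (t := self_text p (code (Sy End))).
  pose (l := at_time 0 1 (start t)).
  assert (Hl : forall y, reval p [enc_elem ((Z.of_nat (enc_elem l), 0, code (Sy End), 1) :: l)] y ->
    exists L R, steps (paved t (enc_elem l)) (if Nat.eqb y 0 then Accept else Reject, L, R))
    by (intros y; apply run_self).
  destruct (Hp ((Z.of_nat (enc_elem l), 0, code (Sy End), 1) :: l)) as [H1 H0].
  { constructor; [apply index_lt, In_all_species|apply valid_at_time]. }
  pose proof (in_basis_events t (enc_elem l)) as Hin. fold l in Hin.
  (* The code of [l] is never to be computed. *)
  clearbody l.
  (* Membership would make [p] return 1, so the machine would reject, contradicting membership. *)
  assert (N : ~ in_subsemimodule basis ((Z.of_nat (enc_elem l), 0, code (Sy End), 1) :: l)).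
  { intros H. destruct (Hl _ (H1 H)) as (L & R & S).
    apply Hin in H. now apply input_rejected in S. }
  (* Hence [p] returns 0 and the machine accepts, which puts the element into the semimodule after
     all. *)
  destruct (Hl _ (H0 N)) as (L & R & S).
  apply N, Hin. eapply input_accepted, S.
Qed.
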